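(* Let $x,y>0$ and let $B^{(L)},B^{(M)},B^{(R)}$ be three independent one-dimensional standard Brownian motions started from $-x$, $0$ and $y$ respectively. Let $$\tau_C^{(B)}=\inf\{t>0:(B_t^{(M)}-B_t^{(L)})(B_t^{(R)}-B_t^{(M)})=0\}.$$ Then $\mathbb E(\tau_C^{(B)})=xy$. *)

(* Defs.v *)
From HB Require Import structures.
From mathcomp Require Import all_boot all_order all_algebra.
From mathcomp Require Import all_classical all_reals all_analysis.

Set Implicit Arguments.
Unset Strict Implicit.
Unset Printing Implicit Defensive.

Import Order.TTheory GRing.Theory Num.Theory.
Import numFieldNormedType.Exports.

Local Open Scope classical_set_scope.
Local Open Scope ring_scope.

Definition mutually_independent (d : measure_display) (T : measurableType d)
    (R : realType) (P : probability T R) (I : finType)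
    (F : I -> set (set T)) : Prop :=
  forall (J : {set I}) (E : I -> set T),
    (forall i, i \in J -> F i (E i)) ->
    P (\bigcap_(i in [set` J]) E i) = (\prod_(i in J) P (E i))%E.

Definition sigma_of (d : measure_display) (T : measurableType d)
    (R : realType) (X : T -> R) : set (set T) :=
  preimage_set_system setT X measurable.

(* Processes are indexed by all of [R] for convenience; only the times [0 <= t]
   are ever constrained or observed. *)
Definition sigma_of_process (d : measure_display) (T : measurableType d)
    (R : realType) (X : R -> T -> R) : set (set T) :=
  <<s \bigcup_(t in [set t : R | 0 <= t]) sigma_of (X t) >>.

Definition independent_processes (d : measure_display) (T : measurableType d)
    (R : realType) (P : probability T R) (n : nat)
    (X : n.-tuple (R -> {RV P >-> R})) : Prop :=
  mutually_independent P
    (fun i : 'I_n => sigma_of_process (fun t => tnth X i t : T -> R)).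

Record standard_brownian_motion (d : measure_display) (T : measurableType d)
    (R : realType) (P : probability T R) (a : R)
    (B : R -> {RV P >-> R}) : Prop := {
  sbm_start : {ae P, forall w, B 0 w = a} ;
  sbm_indep_increments : forall (n : nat) (t : nat -> R),
    0 <= t 0%N -> {homo t : i j / (i <= j)%N >-> i <= j} ->
    mutually_independent P
      (fun i : 'I_n => sigma_of (fun w => B (t i.+1) w - B (t i) w)) ;
  (* the second parameter of [normal_prob] is the standard deviation *)
  sbm_gaussian_increments : forall (s t : R), 0 <= s -> s < t ->
    forall A : set R, measurable A ->
      P ((fun w => B t w - B s w) @^-1` A) = normal_prob 0 (Num.sqrt (t - s)) A ;
  sbm_continuous : {ae P, forall w,
    {within `[0, +oo[, continuous (fun t : R => B t w)}}
}.

(* Extended-real valued: the infimum of the empty set is +oo. *)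
Definition collision_time (T : Type) (R : realType) (L M U : R -> T -> R)
    (w : T) : \bar R :=
  ereal_inf [set t%:E | t in
    [set t : R | 0 < t /\ (M t w - L t w) * (U t w - M t w) = 0]].

(* Main.v *)
From HB Require Import structures.
Require Import Defs.
From mathcomp Require Import all_boot all_order all_algebra.
From mathcomp Require Import all_classical all_reals all_analysis.
From mathcomp Require Import measurable_realfun.
From mathcomp Require Import ring lra zify.

Set Implicit Arguments.
Unset Strict Implicit.
Unset Printing Implicit Defensive.

Import Order.TTheory GRing.Theory Num.Theory.
Import numFieldNormedType.Exports.

Local Open Scope classical_set_scope.
Local Open Scope ring_scope.

(** Let [u] and [v] be the gaps between the middle particle and its left and right
neighbours. The pair has generator [d_uu + d_vv - d_uv], so that [u v + t],
[u v (u + v)] and [u ^ 2 + v ^ 2 - 4 t] are martingales. Stopping the first one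
at the collision, where [u v = 0], suggests that the expected collision time is
the initial value [x y]. What has to be excluded is a contribution of [u v] from
paths that survive up to a large time [t]. The first martingale bounds the
probability of survival by [x y / t], the second one bounds the expectation of
[u v (u + v)] on survival by [x y (x + y)], and since
[u v <= K ^ 2 + u v (u + v) / K], the contribution is at most
[K ^ 2 x y / t + x y (x + y) / K], which is small for [K] large and then [t]
large.

Stopping takes place in discrete time: the gaps are observed on a grid of mesh
[s ^ 2], and the resulting walk is killed when one of them is found below a
threshold [eps]. Given the past, the three increments of a step are independent
centred Gaussian variables (ge0_integral_freeze, grid_increment_indep), and the
martingale identities for one step are polynomial identities in their moments
(integral_step_poly). At the killing time a gap may have jumped from above
[eps] to below [0]; such a jump is at least as long as [eps], and a fourth
moment makes the sum of these errors up to a fixed horizon of order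
[s ^ 2 / eps ^ 3]. This gives two bounds for the expected survival time of the
killed walk (walk_survival_le, walk_survival_ge).

The survival times are then compared with the collision time path by path. A
path that has not collided up to time [s] stays above some positive threshold on
[[0, s]], and a path that has collided is below any given threshold on an
interval, which a fine grid meets (grid_alive_before_collision,
grid_alive_after_collision). Hence the collision time is at most the lower limit
of the survival times when the thresholds tend to [0] with the meshes, and at
least their upper limit when the threshold is fixed. Fatou's lemma turns this
into the two inequalities (collision_expectation_le, collision_expectation_ge).
*)

(** * Gaussian moments *)

Lemma ge0_integral_normal_prob (R : realType) (m s : R) (f : R -> \bar R) :
  measurable_fun [set: R] f -> (forall z, 0 <= f z)%E ->
  (\int[normal_prob m s]_z f z =
   \int[lebesgue_measure]_z (f z * (normal_pdf m s z)%:E))%E.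
Proof.
move=> mf f0; have dom := normal_prob_dominates m s.
rewrite -(Radon_Nikodym_SigmaFinite.change_of_variables dom)//.
have mRN : measurable_fun [set: R]
    (Radon_Nikodym_SigmaFinite.f (normal_prob m s) lebesgue_measure).
  exact: (measurable_int _ (Radon_Nikodym_SigmaFinite.f_integrable dom)).
have mpdf : measurable_fun [set: R] (fun z => (normal_pdf m s z)%:E).
  by apply/measurable_EFinP; exact: measurable_normal_pdf.
apply: ge0_ae_eq_integral => //.
- exact: emeasurable_funM.
- exact: emeasurable_funM.
- by move=> z _; rewrite mule_ge0// Radon_Nikodym_SigmaFinite.f_ge0.
- by move=> z _; rewrite mule_ge0// lee_fin normal_pdf_ge0.
- apply: ae_eqe_mul2l; apply: integral_ae_eq => //.
  + exact: Radon_Nikodym_SigmaFinite.f_integrable.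
  + by move=> A _ mA; rewrite -Radon_Nikodym_SigmaFinite.f_integral.
Qed.

(** When [f] turns one Gaussian density into a multiple of another one, the
integral of [f] is that multiple: no integral has to be computed. *)
Lemma ge0_integral_normal_prob_density (R : realType) (m m' s s' c : R)
    (f : R -> R) :
  measurable_fun [set: R] f -> (forall z, 0 <= f z) -> 0 <= c ->
  (forall z, f z * normal_pdf m s z = c * normal_pdf m' s' z) ->
  (\int[normal_prob m s]_z (f z)%:E = c%:E)%E.
Proof.
move=> mf f0 c0 fE; rewrite ge0_integral_normal_prob//; last first.
  by apply/measurable_EFinP.
under eq_integral do rewrite -EFinM fE EFinM.
rewrite ge0_integralZl_EFin//.
- by rewrite integral_normal_pdf mule1.
- by move=> z _; rewrite lee_fin normal_pdf_ge0.
- by apply/measurable_EFinP; exact: measurable_normal_pdf.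
Qed.

(** Completing the square. *)
Lemma normal_prob_expR (R : realType) (s a : R) : 0 < s ->
  (\int[normal_prob 0 s]_z (expR (a * z))%:E
   = (expR (a ^+ 2 * s ^+ 2 / 2))%:E)%E.
Proof.
move=> s0; apply: (@ge0_integral_normal_prob_density _ _ (a * s ^+ 2) _ s).
- by apply: measurableT_comp => //; exact: measurable_funM.
- by move=> z; exact: expR_ge0.
- exact: expR_ge0.
- move=> z; rewrite !normal_pdfE ?gt_eqF// /normal_fun.
  rewrite mulrCA -expRD [RHS]mulrCA -expRD; congr (_ * expR _).
  by field; rewrite gt_eqF.
Qed.

(** A quadratic exponent only rescales the standard deviation. *)
Lemma normal_prob_expR_sqr (R : realType) (s c : R) : 0 < s ->
  0 < 1 + c * s ^+ 2 ->
  (\int[normal_prob 0 s]_z (expR (- (c * z ^+ 2 / 2)))%:E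
   = ((Num.sqrt (1 + c * s ^+ 2))^-1)%:E)%E.
Proof.
move=> s0 q0; set r := Num.sqrt _.
have r0 : 0 < r by rewrite sqrtr_gt0.
have rr : r ^+ 2 = 1 + c * s ^+ 2 by rewrite sqr_sqrtr// ltW.
apply: (@ge0_integral_normal_prob_density _ _ 0 _ (s / r)).
- apply: measurableT_comp => //; apply: measurableT_comp => //.
  do 2 (apply: measurable_funM => //).
- by move=> z; exact: expR_ge0.
- by rewrite invr_ge0 ltW.
- move=> z; rewrite !normal_pdfE ?gt_eqF ?divr_gt0// /normal_fun.
  rewrite mulrCA -expRD [RHS]mulrA; congr (_ * expR _).
    rewrite /normal_peak expr_div_n.
    have -> : s ^+ 2 / r ^+ 2 * pi *+ 2 = (s ^+ 2 * pi *+ 2) / r ^+ 2.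
      by rewrite mulrAC mulrnAl.
    set q := s ^+ 2 * pi *+ 2.
    have q1 : 0 <= q by rewrite mulrn_wge0// mulr_ge0 ?sqr_ge0 ?pi_ge0.
    rewrite (sqrtrM _ q1) sqrtrV ?sqr_ge0// sqrtr_sqr gtr0_norm// invf_div.
    by rewrite mulrA mulVf ?mul1r// gt_eqF.
  rewrite expr_div_n rr; field; rewrite !gt_eqF//.
Qed.

(** The moments of order 4 and 6 are needed only up to a constant factor; the
exponential [exp (z ^ 2 / 4 s ^ 2)] dominates both powers and its Gaussian
integral is [sqrt 2] whatever [s] is. *)
Lemma expr4_le_expR (R : realType) (z s : R) : 0 < s ->
  z ^+ 4 <= 32 * s ^+ 4 * expR (z ^+ 2 / s ^+ 2 / 4).
Proof.
move=> s0; set w := z ^+ 2 / s ^+ 2 / 4.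
have w0 : 0 <= w by rewrite /w !divr_ge0 ?sqr_ge0.
have -> : z ^+ 4 = 16 * s ^+ 4 * w ^+ 2 by rewrite /w; field; rewrite gt_eqF.
have := expR_ge1Dxn 1 w0; rewrite (_ : 2`!%:R = 2)// => h.
have : w ^+ 2 <= 2 * expR w by lra.
rewrite (_ : 32 * s ^+ 4 * expR w = 16 * s ^+ 4 * (2 * expR w)); last by ring.
by apply: ler_wpM2l; rewrite mulr_ge0// exprn_ge0// ltW.
Qed.

Lemma expr6_le_expR (R : realType) (z s : R) : 0 < s ->
  z ^+ 6 <= 384 * s ^+ 6 * expR (z ^+ 2 / s ^+ 2 / 4).
Proof.
move=> s0; set w := z ^+ 2 / s ^+ 2 / 4.
have w0 : 0 <= w by rewrite /w !divr_ge0 ?sqr_ge0.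
have -> : z ^+ 6 = 64 * s ^+ 6 * w ^+ 3 by rewrite /w; field; rewrite gt_eqF.
have := expR_ge1Dxn 2 w0; rewrite (_ : 3`!%:R = 6)// => h.
have : w ^+ 3 <= 6 * expR w by lra.
rewrite (_ : 384 * s ^+ 6 * expR w = 64 * s ^+ 6 * (6 * expR w)); last by ring.
by apply: ler_wpM2l; rewrite mulr_ge0// exprn_ge0// ltW.
Qed.

Lemma normal_prob_exp_quarter (R : realType) (s : R) : 0 < s ->
  (\int[normal_prob 0 s]_z (expR (z ^+ 2 / s ^+ 2 / 4))%:E <= 2%:E)%E.
Proof.
move=> s0; have s2 : 0 < s ^+ 2 by rewrite exprn_gt0.
pose c := - (2^-1 / s ^+ 2) : R.
have cs : 1 + c * s ^+ 2 = 2^-1.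
  by rewrite /c; field; rewrite gt_eqF.
under eq_integral => z _.
  rewrite (_ : z ^+ 2 / s ^+ 2 / 4 = - (c * z ^+ 2 / 2)); last first.
    by rewrite /c; field; rewrite gt_eqF.
  over.
rewrite normal_prob_expR_sqr ?cs ?invr_gt0// lee_fin.
rewrite -[leRHS]invrK lef_pV2 ?posrE ?invr_gt0 ?sqrtr_gt0//.
by rewrite -[leLHS]ger0_norm// -sqrtr_sqr ler_wsqrtr//; lra.
Qed.

Lemma normal_prob_moment_le (R : realType) (s C : R) (n : nat) :
  0 < s -> 0 <= C -> ~~ odd n ->
  (forall z, z ^+ n <= C * expR (z ^+ 2 / s ^+ 2 / 4)) ->
  (\int[normal_prob 0 s]_z (z ^+ n)%:E <= (C * 2)%:E)%E.
Proof.
move=> s0 C0 n_even zn.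
have mexp : measurable_fun [set: R] (fun z => (expR (z ^+ 2 / s ^+ 2 / 4))%:E).
  apply/measurable_EFinP; apply: measurableT_comp => //.
  by apply: measurable_funM => //; apply: measurable_funM => //.
apply: (@le_trans _ _ (\int[normal_prob 0 s]_z
  (C%:E * (expR (z ^+ 2 / s ^+ 2 / 4))%:E)))%E.
  apply: ge0_le_integral => //.
  - by move=> z _; rewrite lee_fin exprn_even_ge0.
  - by apply/measurable_EFinP; exact: measurable_funX.
  - exact: emeasurable_funM.
  - by move=> z _; rewrite -EFinM lee_fin zn.
rewrite ge0_integralZl_EFin//.
rewrite [leRHS]EFinM; apply: lee_wpmul2l; first by rewrite lee_fin.
exact: normal_prob_exp_quarter.
Qed.

Lemma normal_prob_moment4 (R : realType) (s : R) : 0 < s ->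
  (\int[normal_prob 0 s]_z (z ^+ 4)%:E <= (64 * s ^+ 4)%:E)%E.
Proof.
move=> s0; rewrite (_ : 64 * s ^+ 4 = 32 * s ^+ 4 * 2); last by ring.
apply: (@normal_prob_moment_le _ s (32 * s ^+ 4) 4 s0) => [||z].
- by rewrite mulr_ge0 ?ler0n ?exprn_ge0 ?ltW.
- by [].
- exact: expr4_le_expR.
Qed.

Lemma normal_prob_moment6 (R : realType) (s : R) : 0 < s ->
  (\int[normal_prob 0 s]_z (z ^+ 6)%:E <= (768 * s ^+ 6)%:E)%E.
Proof.
move=> s0; rewrite (_ : 768 * s ^+ 6 = 384 * s ^+ 6 * 2); last by ring.
apply: (@normal_prob_moment_le _ s (384 * s ^+ 6) 6 s0) => [||z].
- by rewrite mulr_ge0 ?ler0n ?exprn_ge0 ?ltW.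
- by [].
- exact: expr6_le_expR.
Qed.

Lemma integral_probability_cst (d : measure_display) (T : measurableType d)
    (R : realType) (P : probability T R) (c : R) : (\int[P]_w c%:E = c%:E)%E.
Proof.
rewrite integral_cst// [X in (_ * X)%E](_ : _ = 1%E) ?mule1//.
exact: (@probability_setT _ _ _ P).
Qed.

Lemma integral_normal_prob_cst (R : realType) (s c : R) :
  (\int[normal_prob 0 s]_z c%:E = c%:E)%E.
Proof. exact: (integral_probability_cst (normal_prob 0 s)). Qed.

Lemma integrable_normal_prob_exprn (R : realType) (s : R) (n : nat) : 0 < s ->
  (n <= 6)%N -> (normal_prob 0 s).-integrable [set: R] (fun z => (z ^+ n)%:E).
Proof.
move=> s0 n6.
have mXn k : measurable_fun [set: R] (fun z : R => (z ^+ k)%:E).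
  by apply/measurable_EFinP; exact: measurable_funX.
have i6 : (normal_prob 0 s).-integrable [set: R] (fun z => (1 + z ^+ 6)%:E).
  apply/integrableP; split.
    by apply/measurable_EFinP; apply: measurable_funD => //; exact: measurable_funX.
  under eq_integral do rewrite gee0_abs ?EFinD ?lee_fin ?addr_ge0 ?exprn_even_ge0//.
  rewrite ge0_integralD//.
  - rewrite integral_normal_prob_cst lte_add_pinfty ?ltry//.
    by rewrite (le_lt_trans (normal_prob_moment6 s0))// ltry.
  - by move=> z _; rewrite lee_fin exprn_even_ge0.
  - exact: mXn.
apply: le_integrable i6 => //; first exact: mXn.
move=> z _; rewrite lee_fin normrX [leRHS]ger0_norm ?addr_ge0 ?exprn_even_ge0//.
have -> : z ^+ 6 = `|z| ^+ 6 by rewrite -normrX ger0_norm// exprn_even_ge0.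
have [z1|/ltW z1] := leP `|z| 1.
  by rewrite (@le_trans _ _ 1)// ?exprn_ile1// lerDl exprn_ge0.
by rewrite (le_trans (ler_weXn2l z1 n6))// lerDr.
Qed.

Lemma eq_of_dist_le_linear (R : realType) (a b c : R) :
  (forall h, 0 < h -> h <= 1 -> `|a - b| <= c * h) -> a = b.
Proof.
move=> H; apply/eqP; rewrite -subr_eq0 -normr_le0; apply/ler_addgt0Pr => e e0.
rewrite add0r; have c0 : 0 <= c.
  by have := le_trans (normr_ge0 _) (H 1 ltr01 (lexx _)); rewrite mulr1.
have ce : 0 < c + e by rewrite ltr_wpDl.
have h0 : 0 < e / (c + e) by rewrite divr_gt0.
have h1 : e / (c + e) <= 1 by rewrite ler_pdivrMr// mul1r lerDr.
apply: (le_trans (H _ h0 h1)).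
by rewrite mulrCA ler_piMr ?(ltW e0)// ler_pdivrMr// mul1r lerDl ltW.
Qed.

(** Both inequalities [1 + a z <= exp (a z)] with [a = h] and [a = - h] bound
the mean by [(exp (h ^ 2 s ^ 2 / 2) - 1) / h], which vanishes with [h]. *)
Lemma normal_prob_mean (R : realType) (s : R) : 0 < s ->
  (\int[normal_prob 0 s]_z z%:E = 0)%E.
Proof.
move=> s0.
have iz : (normal_prob 0 s).-integrable [set: R] (fun z => z%:E).
  by have := integrable_normal_prob_exprn s0 (isT : (1 <= 6)%N).
have [mu muE] : exists mu, (\int[normal_prob 0 s]_z z%:E = mu%:E)%E.
  by exists (fine (\int[normal_prob 0 s]_z z%:E)%E); rewrite fineK// integrable_fin_num.
rewrite muE; congr EFin.
have key (h : R) : 1 + h * mu <= expR (h ^+ 2 * s ^+ 2 / 2).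
  rewrite -lee_fin -(normal_prob_expR _ s0).
  rewrite EFinD EFinM -muE -integralZl//.
  rewrite -(integral_normal_prob_cst s) -integralD//.
  - apply: le_integral => //.
    + apply: integrableD => //; first by have := integrable_normal_prob_exprn s0 (isT : (0 <= 6)%N).
      exact: integrableZl.
    + apply/integrableP; split.
        by apply/measurable_EFinP; apply: measurableT_comp => //.
      under eq_integral do rewrite gee0_abs ?lee_fin ?expR_ge0//.
      by rewrite normal_prob_expR// ltry.
    + by move=> z _; rewrite -EFinM -EFinD lee_fin expR_ge1Dx.
  - by have := integrable_normal_prob_exprn s0 (isT : (0 <= 6)%N).
  - exact: integrableZl.
have exp_le (t : R) : 0 <= t -> expR t <= 1 + t * expR t.
  move=> t0; have := expR_ge1Dx (- t); rewrite expRN => ht.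
  have := ler_wpM2l (expR_ge0 t) ht; rewrite mulrDr mulr1 mulrN divff ?gt_eqF ?expR_gt0//.
  by lra.
apply: (@eq_of_dist_le_linear _ _ _ (s ^+ 2 / 2 * expR (s ^+ 2 / 2))) => h h0 h1.
have hs0 : 0 <= h ^+ 2 * s ^+ 2 / 2 by apply: divr_ge0 => //; apply: mulr_ge0; exact: sqr_ge0.
have hs1 : h ^+ 2 * s ^+ 2 / 2 <= s ^+ 2 / 2.
  by rewrite ler_wpM2r// ler_piMl ?sqr_ge0// exprn_ile1// ltW.
have := exp_le _ hs0.
have : h ^+ 2 * s ^+ 2 / 2 * expR (h ^+ 2 * s ^+ 2 / 2) <=
       h * (s ^+ 2 / 2 * expR (s ^+ 2 / 2) * h).
  rewrite (_ : h * (_ * h) = h ^+ 2 * s ^+ 2 / 2 * expR (s ^+ 2 / 2)); last by ring.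
  by rewrite ler_wpM2l// ler_expR.
have := key h; have := key (- h); rewrite sqrrN mulNr => k1 k2 k3 k4.
rewrite subr0 ler_norml -(ler_pM2l h0) -[X in _ && X](ler_pM2l h0) mulrN.
by apply/andP; split; lra.
Qed.

(** The inequality [1 + a z ^ 2 <= exp (a z ^ 2)], for [a] small of either sign,
encloses the variance between two expressions that tend to [s ^ 2]. *)
Lemma normal_prob_var (R : realType) (s : R) : 0 < s ->
  (\int[normal_prob 0 s]_z (z ^+ 2)%:E = (s ^+ 2)%:E)%E.
Proof.
move=> s0.
have iz : (normal_prob 0 s).-integrable [set: R] (fun z => (z ^+ 2)%:E).
  exact: integrable_normal_prob_exprn.
have [v vE] : exists v, (\int[normal_prob 0 s]_z (z ^+ 2)%:E = v%:E)%E.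
  by exists (fine (\int[normal_prob 0 s]_z (z ^+ 2)%:E)%E); rewrite fineK// integrable_fin_num.
rewrite vE; congr EFin.
have s2 : 0 < s ^+ 2 by rewrite exprn_gt0.
have key (c : R) : 0 < 1 + c * s ^+ 2 -> 1 - c / 2 * v <= (Num.sqrt (1 + c * s ^+ 2))^-1.
  move=> cs.
  have mexp : measurable_fun [set: R] (fun z : R => expR (- (c * z ^+ 2 / 2))).
    apply: measurableT_comp => //; apply: measurableT_comp => //.
    by do ?[apply: measurable_funM => //].
  rewrite -lee_fin -(normal_prob_expR_sqr s0 cs).
  rewrite -mulNr EFinD EFinM -vE -integralZl//.
  rewrite -(integral_normal_prob_cst s) -integralD//.
  - apply: le_integral => //.
    + apply: integrableD => //; first by have := integrable_normal_prob_exprn s0 (isT : (0 <= 6)%N).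
      exact: integrableZl.
    + apply/integrableP; split.
        by apply/measurable_EFinP; exact: mexp.
      under eq_integral do rewrite gee0_abs ?lee_fin ?expR_ge0//.
      by rewrite normal_prob_expR_sqr// ltry.
    + move=> z _; rewrite -EFinM -EFinD lee_fin.
      by rewrite (_ : - (c / 2) * z ^+ 2 = - (c * z ^+ 2 / 2)) ?expR_ge1Dx//; ring.
  - by have := integrable_normal_prob_exprn s0 (isT : (0 <= 6)%N).
  - exact: integrableZl.
(* [1 / sqrt (1 + t) <= 1 - t / 2 + t ^ 2] near [0] *)
have inv_sqrt (t : R) : - (1 / 4) <= t -> t <= 1 / 4 ->
    (Num.sqrt (1 + t))^-1 <= 1 - t / 2 + t ^+ 2.
  move=> t1 t2; have q0 : 0 < 1 - t / 2 + t ^+ 2 by nra.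
  rewrite -[leRHS]invrK lef_pV2 ?posrE ?invr_gt0 ?sqrtr_gt0//; last by lra.
  rewrite -[leLHS]gtr0_norm ?invr_gt0// -sqrtr_sqr ler_wsqrtr//.
  rewrite exprVn -div1r ler_pdivrMr ?exprn_gt0//.
  have p0 : 0 <= 5 / 4 + 5 / 4 * t + t ^+ 3 by nra.
  have -> : (1 + t) * (1 - t / 2 + t ^+ 2) ^+ 2 =
    1 + t ^+ 2 * (5 / 4 + 5 / 4 * t + t ^+ 3) by field.
  by rewrite lerDl mulr_ge0// sqr_ge0.
apply: (@eq_of_dist_le_linear _ _ _ (s ^+ 2)) => h h0 h1.
(* so scaled that [c * s ^+ 2] lies in the range of [inv_sqrt] *)
pose c := h / s ^+ 2 / 4.
have cs : c * s ^+ 2 = h / 4 by rewrite /c; field; rewrite gt_eqF.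
have := key c; rewrite cs => /(_ ltac:(lra)) k1.
have := key (- c); rewrite mulNr cs => /(_ ltac:(lra)) k2.
have := inv_sqrt (h / 4) ltac:(lra) ltac:(lra) => i1.
have := inv_sqrt (- (h / 4)) ltac:(lra) ltac:(lra) => i2.
pose V := v / s ^+ 2.
have vV : v = V * s ^+ 2 by rewrite /V divfK// gt_eqF.
have cv : c / 2 * v = h * V / 8 by rewrite /c vV; field; rewrite gt_eqF.
move: k1 k2; rewrite mulNr mulNr opprK cv => k1 k2.
have V1 : 1 - h / 2 <= V by rewrite -(ler_pM2l h0); lra.
have V2 : V <= 1 + h / 2 by rewrite -(ler_pM2l h0); lra.
rewrite vV -[X in _ - X]mul1r -mulrBl normrM (gtr0_norm s2) mulrC ler_wpM2l ?(ltW s2)//.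
by rewrite ler_norml; apply/andP; split; lra.
Qed.

Definition normal_moment (R : realType) (s : R) (n : nat) : R :=
  fine (\int[normal_prob 0 s]_z (z ^+ n)%:E)%E.

Lemma integral_normal_prob_poly (R : realType) (s c0 c1 c2 c4 c6 : R) :
  0 < s ->
  (\int[normal_prob 0 s]_z
     (c0 + c1 * z + c2 * z ^+ 2 + c4 * z ^+ 4 + c6 * z ^+ 6)%:E
   = (c0 + c2 * s ^+ 2 + c4 * normal_moment s 4
      + c6 * normal_moment s 6)%:E)%E.
Proof.
move=> s0.
have iX n : (n <= 6)%N -> (normal_prob 0 s).-integrable [set: R]
    (fun z => (z ^+ n)%:E) by exact: integrable_normal_prob_exprn.
have iM c n : (n <= 6)%N -> (normal_prob 0 s).-integrable [set: R]
    (fun z => (c * z ^+ n)%:E).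
  by move=> n6; under eq_fun do rewrite EFinM; exact/integrableZl/iX.
have iMn c n : (n <= 6)%N -> (\int[normal_prob 0 s]_z (c * z ^+ n)%:E =
    c%:E * \int[normal_prob 0 s]_z (z ^+ n)%:E)%E.
  by move=> n6; under eq_integral do rewrite EFinM; rewrite integralZl//; exact: iX.
have i0 : (normal_prob 0 s).-integrable [set: R] (fun=> c0%:E).
  by have := iM c0 0%N isT; under eq_fun do rewrite expr0 mulr1.
have i1 : (normal_prob 0 s).-integrable [set: R] (fun z => (c1 * z)%:E).
  exact: (iM c1 1%N isT).
have i01 : (normal_prob 0 s).-integrable [set: R] (fun z => (c0 + c1 * z)%:E).
  by under eq_fun do rewrite EFinD; exact: integrableD.
have i2 : (normal_prob 0 s).-integrable [set: R]
    (fun z => (c0 + c1 * z + c2 * z ^+ 2)%:E).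
  by under eq_fun do rewrite EFinD; apply: integrableD => //; exact: iM.
have i4 : (normal_prob 0 s).-integrable [set: R]
    (fun z => (c0 + c1 * z + c2 * z ^+ 2 + c4 * z ^+ 4)%:E).
  by under eq_fun do rewrite EFinD; apply: integrableD => //; exact: iM.
under eq_integral do rewrite EFinD.
rewrite integralD//; last exact: iM.
under eq_integral do rewrite EFinD.
rewrite integralD//; last exact: iM.
under eq_integral do rewrite EFinD.
rewrite integralD//; last exact: iM.
under eq_integral do rewrite EFinD.
rewrite integralD//.
rewrite integral_normal_prob_cst (iMn c1 1%N isT) !iMn//.
rewrite normal_prob_mean// normal_prob_var// mule0 adde0.
rewrite 3!EFinD !EFinM /normal_moment !fineK//; apply: integrable_fin_num => //; exact: iX.
Qed.

(** * One step of the three particles *)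

(** [u + m - l] and [v + r - m] are the gaps between neighbours after the three
particles have moved by [l], [m] and [r]; the terms in [k4] and [k6] leave room
for the overshoot. *)
Definition step_poly (R : realType) (e0 e1 e2 e3 e4 k4 k6 u v l m r : R) : R :=
  let u' := u + m - l in let v' := v + r - m in
  e0 + e1 * (u' * v') + e2 * (u' * v' * (u' + v')) +
  e3 * (u' ^+ 2 + v' ^+ 2) + e4 * (u' + v') +
  k4 * (l ^+ 4 + m ^+ 4 + r ^+ 4) + k6 * (l ^+ 6 + m ^+ 6 + r ^+ 6).

(** One step of the martingales: up to the room left for the overshoot, the
expectations of [u v], [u v (u + v)], [u ^ 2 + v ^ 2] and [u + v] change by
[- s ^ 2], [0], [4 s ^ 2] and [0]. The cubic is, up to sign, the Vandermonde
determinant of the three positions, in which every monomial contains one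
position to the first power. *)
Lemma integral_step_poly (R : realType) (s e0 e1 e2 e3 e4 k4 k6 u v : R) :
  0 < s ->
  (\int[normal_prob 0 s]_l \int[normal_prob 0 s]_m \int[normal_prob 0 s]_r
     (step_poly e0 e1 e2 e3 e4 k4 k6 u v l m r)%:E
   = (e0 + e1 * (u * v - s ^+ 2) + e2 * (u * v * (u + v)) +
      e3 * (u ^+ 2 + v ^+ 2 + 4 * s ^+ 2) + e4 * (u + v) +
      3 * (k4 * normal_moment s 4 + k6 * normal_moment s 6))%:E)%E.
Proof.
move=> s0; set M4 := normal_moment s 4; set M6 := normal_moment s 6.
pose K := k4 * M4 + k6 * M6.
under eq_integral => l _.
  under eq_integral => m _.
    under eq_integral => r _.
      have -> : step_poly e0 e1 e2 e3 e4 k4 k6 u v l m r =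
        (e0 + e1 * ((u + m - l) * (v - m)) +
         e2 * ((u + m - l) * (v - m) * (u + v - l)) +
         e3 * ((u + m - l) ^+ 2 + (v - m) ^+ 2) + e4 * (u + v - l) +
         k4 * (l ^+ 4 + m ^+ 4) + k6 * (l ^+ 6 + m ^+ 6)) +
        (e1 * (u + m - l) + e2 * ((u + m - l) * (u + v - l + (v - m))) +
         e3 * (2 * (v - m)) + e4) * r +
        (e2 * (u + m - l) + e3) * r ^+ 2 + k4 * r ^+ 4 + k6 * r ^+ 6.
        by rewrite /step_poly /=; ring.
      over.
    rewrite integral_normal_prob_poly// -/M4 -/M6.
    rewrite (_ : _ + k6 * M6 =
        (e0 + e1 * ((u - l) * v) + e2 * ((u - l) * v * (u + v - l)) +
         e3 * ((u - l) ^+ 2 + v ^+ 2) + e4 * (u + v - l) +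
         k4 * l ^+ 4 + k6 * l ^+ 6 + (e2 * (u - l) + e3) * s ^+ 2 + K) +
        (e1 * (v - (u - l)) + e2 * ((v - (u - l)) * (u + v - l)) +
         e3 * (2 * (u - l - v)) + e2 * s ^+ 2) * m +
        (2 * e3 - e1 - e2 * (u + v - l)) * m ^+ 2 +
        k4 * m ^+ 4 + k6 * m ^+ 6); last by rewrite /K; ring.
    over.
  rewrite integral_normal_prob_poly// -/M4 -/M6.
  rewrite (_ : _ + k6 * M6 =
      (e0 + e1 * (u * v) + e2 * (u * v * (u + v)) +
       e3 * (u ^+ 2 + v ^+ 2) + e4 * (u + v) +
       (3 * e3 - e1 - e2 * v) * s ^+ 2 + 2 * K) +
      (- e1 * v - e2 * (v * (v + 2 * u)) - e3 * (2 * u) - e4) * l +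
      (e2 * v + e3) * l ^+ 2 +
      k4 * l ^+ 4 + k6 * l ^+ 6); last by rewrite /K; ring.
  over.
rewrite integral_normal_prob_poly// -/M4 -/M6; congr EFin.
by rewrite /K; ring.
Qed.

(** * Independence of the past and the future *)

Definition future_event (T : Type) (R : realType) (X : nat -> T -> R)
    (E : nat -> set R) (j n : nat) : set T :=
  \bigcap_(i in [set i | (j <= i < n)%N]) X i @^-1` E i.

(** Independence is tested on rectangles of the increments [X i], [j <= i < n];
they suffice because the increments are later revealed one at a time. *)
Definition independent_of_future (d d' : measure_display)
    (T : measurableType d) (S : measurableType d') (R : realType)
    (P : probability T R) (X : nat -> T -> R) (n : nat) (U : T -> S) (j : nat) :=
  forall (A : set S) (E : nat -> set R), measurable A ->
    (forall i, measurable (E i)) ->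
    P (U @^-1` A `&` future_event X E j n) =
    (P (U @^-1` A) * P (future_event X E j n))%E.

Lemma measurable_future_event (d : measure_display) (T : measurableType d)
    (R : realType) (X : nat -> T -> R) (E : nat -> set R) (j n : nat) :
  (forall i, measurable_fun [set: T] (X i)) -> (forall i, measurable (E i)) ->
  measurable (future_event X E j n).
Proof.
move=> mX mE; apply: bigcap_measurableType => i _.
by rewrite -[X in measurable X]setTI; exact: mX.
Qed.

Lemma future_event_recl (T : Type) (R : realType) (X : nat -> T -> R)
    (E : nat -> set R) (j n : nat) : (j < n)%N ->
  future_event X E j n = X j @^-1` E j `&` future_event X E j.+1 n.
Proof.
move=> jn; apply/seteqP; split=> [w h|w [hj h] i /= /andP[ji ni]].
  split; first by apply: h; rewrite /= leqnn.
  by move=> i /= /andP[ji ni]; apply: h; rewrite /= (ltnW ji).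
by move: ji; rewrite leq_eqVlt => /predU1P[<-//|ji]; apply: h; rewrite /= ji.
Qed.

Lemma future_event_setT (T : Type) (R : realType) (X : nat -> T -> R) (j n : nat) :
  future_event X (fun=> setT) j n = setT.
Proof. by apply/seteqP; split. Qed.

Lemma independent_of_future_comp (d d' d'' : measure_display)
    (T : measurableType d) (S : measurableType d') (S' : measurableType d'')
    (R : realType) (P : probability T R) (X : nat -> T -> R) (n : nat)
    (U : T -> S) (j : nat) (f : S -> S') : measurable_fun [set: S] f ->
  independent_of_future P X n U j ->
  independent_of_future P X n (f \o U) j.
Proof.
move=> mf indU A E mA mE; rewrite comp_preimage; apply: indU => //.
by rewrite -[X in measurable X]setTI; exact: mf.
Qed.

Lemma independent_of_future_cst (d d' : measure_display)
    (T : measurableType d) (S : measurableType d') (R : realType)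
    (P : probability T R) (X : nat -> T -> R) (n : nat) (c : S) (j : nat) :
  independent_of_future P X n (fun=> c) j.
Proof.
move=> A E mA mE; have [cA|cA] := pselect (A c).
  have -> : (fun=> c) @^-1` A = [set: T] by apply/seteqP; split.
  by rewrite setTI probability_setT mul1e.
have -> : (fun=> c) @^-1` A = @set0 T by apply/seteqP; split.
by rewrite set0I measure0 mul0e.
Qed.

Definition independent_sequence (d : measure_display) (T : measurableType d)
    (R : realType) (P : probability T R) (X : nat -> T -> R) (n : nat) :=
  forall (E : nat -> set R) (j : nat), (forall i, measurable (E i)) ->
    (j < n)%N -> P (future_event X E j n) =
      (P (X j @^-1` E j) * P (future_event X E j.+1 n))%E.

Section freezing.
Context (d d' : measure_display) (T : measurableType d)
  (S : measurableType d') (R : realType) (P : probability T R)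
  (X : nat -> T -> R) (n : nat) (U : T -> S) (j : nat).
Hypothesis mX : forall i, measurable_fun [set: T] (X i).
Hypothesis indX : independent_sequence P X n.
Hypothesis mU : measurable_fun [set: T] U.
Hypothesis indU : independent_of_future P X n U j.
Hypothesis jn : (j < n)%N.

Let V (w : T) : S * R := (U w, X j w).

Let mV : measurable_fun [set: T] V.
Proof. exact/measurable_fun_pair. Qed.

Let V_mixin := isMeasurableFun.Build _ _ _ _ _ mV.
Let VM : {mfun T >-> (S * R)%type} := HB.pack V V_mixin.
Let U_mixin := isMeasurableFun.Build _ _ _ _ _ mU.
Let UM : {mfun T >-> S} := HB.pack U U_mixin.

Let rect_future (A : set S) (B : set R) (E : nat -> set R) :
  measurable A -> measurable B -> (forall i, measurable (E i)) ->
  P (V @^-1` (A `*` B) `&` future_event X E j.+1 n) =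
  (P (U @^-1` A) * P (X j @^-1` B) * P (future_event X E j.+1 n))%E.
Proof.
move=> mA mB mE; pose E' i := if i == j then B else E i.
have mE' i : measurable (E' i) by rewrite /E'; case: ifP.
have E'E : future_event X E' j.+1 n = future_event X E j.+1 n.
  apply: eq_bigcapr => i /= /andP[ji _]; congr (_ @^-1` _).
  by rewrite /E' gtn_eqF.
have E'j : E' j = B by rewrite /E' eqxx.
have := indU mA mE'; rewrite indX// E'E E'j muleA => <-.
by congr (P _); rewrite (future_event_recl X E' jn) E'E E'j setIA.
Qed.

Let rect (A : set S) (B : set R) : measurable A -> measurable B ->
  P (V @^-1` (A `*` B)) = (P (U @^-1` A) * P (X j @^-1` B))%E.
Proof.
move=> mA mB; have := @rect_future A B (fun=> setT) mA mB (fun=> measurableT).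
by rewrite future_event_setT setIT probability_setT mule1.
Qed.

(** For a fixed future event, the two sides are measures in the set of values of
the pair, and they agree on rectangles. *)
Lemma independent_of_future_pair :
  independent_of_future P X n (fun w => (U w, X j w)) j.+1.
Proof.
move=> C E mC mE.
have mF := measurable_future_event j.+1 n mX mE.
set F := future_event X E j.+1 n in mF *.
have PF : P F = (fine (P F))%:E by rewrite fineK// fin_num_measure.
have PF0 : 0 <= fine (P F) by rewrite fine_ge0.
pose c : {nonneg R} := NngNum PF0.
pose m1 : {measure set (S * R) -> \bar R} :=
  measure_function_pushforward__canonical__measure_function_Measure
    (mrestr P mF) mV.
suff : m1 C = mscale c (distribution P VM) C.
  by rewrite /m1 /mscale /pushforward /mrestr /= -PF muleC.
pose G : set (set (S * R)) :=
  [set G | exists2 A, measurable A & exists2 B, measurable B & G = A `*` B].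
apply: (measure_unique G (fun=> setT)) => //.
- rewrite measurable_prod_measurableType; congr (<<s _ >>).
  rewrite predeqE; split => [[A mA [B mB <-]]|[A mA [B mB ->]]].
    by exists A => //; exists B.
  by exists A => //; exists B.
- move=> _ _ [A mA [B mB ->]] [A' mA' [B' mB' ->]]; rewrite -setXI.
  by exists (A `&` A'); [exact: measurableI|exists (B `&` B') => //; exact: measurableI].
- by move=> i; exists setT => //; exists setT; rewrite ?setXTT.
- by apply: bigcup_const; exists 0%N.
- move=> _ [A mA [B mB ->]].
  transitivity (P (V @^-1` (A `*` B) `&` F)); first by [].
  transitivity (P F * P (V @^-1` (A `*` B)))%E; last by rewrite [in LHS]PF.
  by rewrite rect_future// rect// muleC.
- move=> k; rewrite /m1 /= /pushforward /mrestr preimage_setT setTI.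
  by rewrite -ge0_fin_numE// fin_num_measure.
Qed.

Let ge0_integral_freeze_aux (nu : probability R R) (g : S * R -> \bar R) :
  (forall B, measurable B -> P (X j @^-1` B) = nu B) ->
  measurable_fun [set: S * R] g -> (forall z, 0 <= g z)%E ->
  (\int[P]_w g (U w, X j w) = \int[P]_w \int[nu]_z g (U w, z))%E.
Proof.
move=> nuE mg g0.
have -> : (\int[P]_w g (U w, X j w) = \int[distribution P VM]_z g z)%E.
  by rewrite ge0_integral_distribution.
have VE : forall C, measurable C ->
    distribution P VM C = (distribution P UM \x nu)%E C.
  move=> C mC; apply/esym/product_measure_unique => // A B mA mB.
  by rewrite [LHS]rect// nuE.
rewrite (eq_measure_integral (distribution P UM \x nu)%E); last first.
  by move=> C mC _; exact: VE.
rewrite fubini_tonelli1// ge0_integral_distribution//.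
- exact: measurable_fun_fubini_tonelli_F.
- by move=> u; apply: integral_ge0.
Qed.

(** The freezing lemma: the increment that comes next is integrated out with
everything that precedes it held fixed. *)
Lemma ge0_integral_freeze (nu : probability (measurableTypeR R) R)
    (g : S * R -> \bar R) :
  (forall B, measurable B -> P (X j @^-1` B) = nu B) ->
  measurable_fun [set: S * R] g -> (forall z, 0 <= g z)%E ->
  (\int[P]_w g (U w, X j w) = \int[P]_w \int[nu]_z g (U w, z))%E.
Proof.
move=> nuE mg g0.
(* [nu] lives on the Borel copy of [R]; it is transported to [R] itself *)
pose idR : measurableTypeR R -> R := idfun.
have midR : measurable_fun [set: measurableTypeR R] idR by exact: measurable_id.
pose idM : {mfun measurableTypeR R >-> R} := mfun_Sub (mem_set midR).
have := @ge0_integral_freeze_aux (distribution nu idM) g nuE mg g0 => ->.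
apply: eq_integral => w _; rewrite ge0_integral_distribution//.
apply: (measurableT_comp mg); apply/measurable_fun_pair => /=.
  exact: measurable_cst.
exact: measurable_id.
Qed.

End freezing.

(** * Overshoot of a killed step *)

(** A gap that is at least [eps] can only become negative through an increment
[c] with [eps <= `|c|], and then [`|c| <= c ^ 4 / eps ^ 3]. *)
Lemma undershoot_le (R : realType) (eps w c S : R) :
  0 < eps -> eps <= w -> c ^+ 2 <= 2 * S -> w + c < 0 ->
  - (w + c) <= 4 * S ^+ 2 / eps ^+ 3 /\ (w + c) ^+ 2 <= 2 * S.
Proof.
move=> eps0 hw c2S wc0; have c_eps : eps <= - c by lra.
have S0 : 0 <= 2 * S by apply: le_trans c2S; exact: sqr_ge0.
split; last first.
  by apply: le_trans c2S; rewrite -[leLHS]sqrrN -[leRHS]sqrrN ler_pXn2r ?nnegrE//; lra.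
apply: (@le_trans _ _ (- c)); first by lra.
rewrite ler_pdivlMr ?exprn_gt0//.
have c3 : eps ^+ 3 <= (- c) ^+ 3 by rewrite ler_pXn2r ?nnegrE//; lra.
have c4 : (c ^+ 2) ^+ 2 <= (2 * S) ^+ 2 by rewrite ler_pXn2r ?nnegrE ?sqr_ge0.
have h : - c * eps ^+ 3 <= - c * (- c) ^+ 3 by rewrite ler_wpM2l//; lra.
have e1 : - c * (- c) ^+ 3 = (c ^+ 2) ^+ 2 by ring.
have e2 : (2 * S) ^+ 2 = 4 * S ^+ 2 by ring.
by rewrite (le_trans h)// e1 -e2.
Qed.

(** A common bound for the three overshoots below, where [S] stands for the sum
of the squared increments. Every term is at least quadratic in [S], so that the
Gaussian expectation is of order [s ^ 4] and remains small when added up over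
[t / s ^ 2] steps. *)
Definition overshoot (R : realType) (eps u v S : R) : R :=
  48 * S ^+ 2 / eps ^+ 3 * (1 + u ^+ 2 + v ^+ 2 + S).

Lemma overshootC (R : realType) (eps u v S : R) :
  overshoot eps u v S = overshoot eps v u S.
Proof. by rewrite /overshoot; ring. Qed.

Lemma overshoot_ge0 (R : realType) (eps u v S : R) : 0 < eps -> 0 <= S ->
  0 <= overshoot eps u v S.
Proof.
move=> eps0 S0; rewrite /overshoot mulr_ge0//.
  rewrite divr_ge0 ?exprn_ge0 ?(ltW eps0)// mulr_ge0 ?sqr_ge0//.
by rewrite ?addr_ge0 ?sqr_ge0.
Qed.

Lemma le_overshoot (R : realType) (eps u v S t A : R) :
  0 < eps -> 0 <= S -> 0 <= t -> t <= 4 * S ^+ 2 / eps ^+ 3 ->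
  A <= 12 * (1 + u ^+ 2 + v ^+ 2 + S) -> t * A <= overshoot eps u v S.
Proof.
move=> eps0 S0 t0 tZ hA.
have q0 : 0 <= 12 * (1 + u ^+ 2 + v ^+ 2 + S) by rewrite mulr_ge0// !addr_ge0 ?sqr_ge0.
rewrite (le_trans (ler_wpM2l t0 hA))// (le_trans (ler_wpM2r q0 tZ))//.
by rewrite /overshoot le_eqVlt; apply/orP; left; apply/eqP; ring.
Qed.

Section overshoot_bounds.
Variables (R : realType) (eps : R).

Let le_moderate (u v b S : R) : 0 <= S -> b ^+ 2 <= 2 * S ->
  v + b <= 1 + u ^+ 2 + v ^+ 2 + S.
Proof.
move=> S0 b2; have h1 := sqr_ge0 (v - 1); have h2 := sqr_ge0 (b - 1).
have h3 := sqr_ge0 u; nra.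
Qed.

Let prod_aux (u v a b S : R) : 0 < eps -> eps <= u -> a ^+ 2 <= 2 * S ->
  b ^+ 2 <= 2 * S -> u + a < 0 -> 0 <= (u + a) * (v + b) + overshoot eps u v S.
Proof.
move=> eps0 hu a2 b2 ua; have [tZ tS] := undershoot_le eps0 hu a2 ua.
have S0 : 0 <= S by have := sqr_ge0 a; lra.
rewrite -[X in X * _]opprK mulNr addrC subr_ge0 le_overshoot//; first by lra.
by have := le_moderate u v S0 b2; have := sqr_ge0 u; have := sqr_ge0 v; lra.
Qed.

Lemma prod_ge_overshoot (u v a b S : R) : 0 < eps -> eps <= u -> eps <= v ->
  a ^+ 2 <= 2 * S -> b ^+ 2 <= 2 * S ->
  0 <= (u + a) * (v + b) + overshoot eps u v S.
Proof.
move=> eps0 hu hv a2 b2; have S0 : 0 <= S by have := sqr_ge0 a; lra.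
have [ua|ua] := ltP (u + a) 0; first exact: prod_aux.
have [vb|vb] := ltP (v + b) 0.
  by rewrite mulrC overshootC; exact: prod_aux.
by apply: addr_ge0; [exact: mulr_ge0|exact: overshoot_ge0].
Qed.

Let cubic_aux (u v a b S : R) : 0 < eps -> eps <= u -> a ^+ 2 <= 2 * S ->
  b ^+ 2 <= 2 * S -> u + a < 0 ->
  0 <= (u + a) * (v + b) * (u + a + (v + b)) + overshoot eps u v S.
Proof.
move=> eps0 hu a2 b2 ua; have [tZ tS] := undershoot_le eps0 hu a2 ua.
have S0 : 0 <= S by have := sqr_ge0 a; lra.
set t := - (u + a) in tZ; have t0 : 0 <= t by rewrite /t; lra.
have -> : (u + a) * (v + b) * (u + a + (v + b)) =
    - (t * ((v + b) * (v + b - t))) by rewrite /t; ring.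
rewrite addrC subr_ge0 le_overshoot//.
have {}tS : t ^+ 2 <= 2 * S by rewrite /t sqrrN.
have h1 := sqr_ge0 (v + b + t); have h2 := sqr_ge0 (v - b).
have h3 := sqr_ge0 u; have h4 := sqr_ge0 v.
by nra.
Qed.

Lemma cubic_ge_overshoot (u v a b S : R) : 0 < eps -> eps <= u -> eps <= v ->
  a ^+ 2 <= 2 * S -> b ^+ 2 <= 2 * S ->
  0 <= (u + a) * (v + b) * (u + a + (v + b)) + overshoot eps u v S.
Proof.
move=> eps0 hu hv a2 b2; have S0 : 0 <= S by have := sqr_ge0 a; lra.
have [ua|ua] := ltP (u + a) 0; first exact: cubic_aux.
have [vb|vb] := ltP (v + b) 0.
  by rewrite (mulrC (u + a)) (addrC (u + a)) overshootC; exact: cubic_aux.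
apply: addr_ge0; last exact: overshoot_ge0.
by apply: mulr_ge0; [exact: mulr_ge0|exact: addr_ge0].
Qed.

Let shifted_aux (u v a b S : R) : 0 < eps -> eps <= 1 -> eps <= u ->
  a ^+ 2 <= 2 * S -> b ^+ 2 <= 2 * S -> u + a < 0 -> 0 <= v + b ->
  (u + a) * (v + b) - eps * (u + a + (v + b)) <= overshoot eps u v S.
Proof.
move=> eps0 eps1 hu a2 b2 ua vb.
have [tZ tS] := undershoot_le eps0 hu a2 ua.
have S0 : 0 <= S by have := sqr_ge0 a; lra.
set t := - (u + a) in tZ; have t0 : 0 <= t by rewrite /t; lra.
have : t * 1 <= overshoot eps u v S.
  by rewrite le_overshoot//; have := sqr_ge0 u; have := sqr_ge0 v; lra.
have h1 : (u + a) * (v + b) <= 0 by rewrite nmulr_rle0.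
have h2 : eps * t <= t by rewrite ler_piMl.
have h3 : 0 <= eps * (v + b) by rewrite mulr_ge0// ltW.
have h4 : eps * t = - (eps * (u + a)) by rewrite /t mulrN.
by lra.
Qed.

(** Subtracting [eps * (u + v)] makes the product nonpositive on the part of the
quadrant where one gap is below [eps]; only the overshoot is left. *)
Lemma shifted_prod_le_overshoot (u v a b S : R) : 0 < eps -> eps <= 1 ->
  eps <= u -> eps <= v -> a ^+ 2 <= 2 * S -> b ^+ 2 <= 2 * S ->
  ~~ ((eps <= u + a) && (eps <= v + b)) ->
  (u + a) * (v + b) - eps * (u + a + (v + b)) <= overshoot eps u v S.
Proof.
move=> eps0 eps1 hu hv a2 b2 exit; have S0 : 0 <= S by have := sqr_ge0 a; lra.
have [ua|ua] := ltP (u + a) 0; have [vb|vb] := ltP (v + b) 0.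
- have [tZ tS] := undershoot_le eps0 hu a2 ua.
  have [rZ rS] := undershoot_le eps0 hv b2 vb.
  set t := - (u + a) in tZ; set r := - (v + b) in rZ.
  have t0 : 0 <= t by rewrite /t; lra.
  have r0 : 0 <= r by rewrite /r; lra.
  have r2 : r ^+ 2 <= 2 * S by rewrite /r sqrrN.
  have h1 : t * r + r + t <= overshoot eps u v S.
    have [tr|rt] := leP r t.
      apply: (@le_trans _ _ (t * (r + 2))); first by lra.
      rewrite le_overshoot//.
      by have := sqr_ge0 (r - 1); have := sqr_ge0 u; have := sqr_ge0 v; nra.
    have t2 : t ^+ 2 <= 2 * S by rewrite /t sqrrN.
    apply: (@le_trans _ _ (r * (t + 2))); first by lra.
    rewrite le_overshoot//.
    by have := sqr_ge0 (t - 1); have := sqr_ge0 u; have := sqr_ge0 v; nra.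
  have h2 : eps * t <= t by rewrite ler_piMl.
  have h3 : eps * r <= r by rewrite ler_piMl.
  have h4 : (u + a) * (v + b) - eps * (u + a + (v + b)) =
    t * r + (eps * t + eps * r) by rewrite /t /r; ring.
  by rewrite h4; lra.
- exact: shifted_aux.
- by rewrite mulrC (addrC (u + a)) overshootC; exact: shifted_aux.
- apply: (@le_trans _ _ 0); last exact: overshoot_ge0.
  have h0 : 0 <= eps * (u + a) by rewrite mulr_ge0// ltW.
  have h0' : 0 <= eps * (v + b) by rewrite mulr_ge0// ltW.
  move: exit; rewrite negb_and -!ltNge => /orP[h|h].
    have : (u + a) * (v + b) <= eps * (v + b) by rewrite ler_wpM2r// ltW.
    by lra.
  have : (u + a) * (v + b) <= (u + a) * eps by rewrite ler_wpM2l// ltW.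
  by lra.
Qed.

End overshoot_bounds.

Lemma overshoot_le_step_poly (R : realType) (eps u v l m r : R) : 0 < eps ->
  overshoot eps u v (l ^+ 2 + m ^+ 2 + r ^+ 2) <=
  step_poly 0 0 0 0 0 (144 / eps ^+ 3 * (1 + u ^+ 2 + v ^+ 2))
    (432 / eps ^+ 3) u v l m r.
Proof.
move=> eps0; set S := l ^+ 2 + m ^+ 2 + r ^+ 2; set q := 1 + u ^+ 2 + v ^+ 2.
have q0 : 0 <= q by rewrite !addr_ge0 ?sqr_ge0.
have k0 : 0 <= 48 / eps ^+ 3 by rewrite divr_ge0// exprn_ge0// ltW.
have h2 : S ^+ 2 <= 3 * (l ^+ 4 + m ^+ 4 + r ^+ 4).
  have h1 := sqr_ge0 (l ^+ 2 - m ^+ 2); have h2 := sqr_ge0 (m ^+ 2 - r ^+ 2).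
  by have h3 := sqr_ge0 (l ^+ 2 - r ^+ 2); rewrite /S; lra.
have h3 : S ^+ 3 <= 9 * (l ^+ 6 + m ^+ 6 + r ^+ 6).
  (* power means: [(a + b + c) ^ 3 <= 9 (a ^ 3 + b ^ 3 + c ^ 3)] *)
  have pm (a b c : R) : 0 <= a -> 0 <= b -> 0 <= c ->
      (a + b + c) ^+ 3 <= 9 * (a ^+ 3 + b ^+ 3 + c ^+ 3).
    move=> a0 b0 c0.
    have p1 : 0 <= (a + b) * (a - b) ^+ 2 by rewrite mulr_ge0 ?sqr_ge0 ?addr_ge0.
    have p2 : 0 <= (b + c) * (b - c) ^+ 2 by rewrite mulr_ge0 ?sqr_ge0 ?addr_ge0.
    have p3 : 0 <= (a + c) * (a - c) ^+ 2 by rewrite mulr_ge0 ?sqr_ge0 ?addr_ge0.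
    have p4 : 0 <= (a + b + c) * ((a - b) ^+ 2 + (b - c) ^+ 2 + (a - c) ^+ 2).
      by rewrite mulr_ge0 ?addr_ge0 ?sqr_ge0.
    by lra.
  have := pm _ _ _ (sqr_ge0 l) (sqr_ge0 m) (sqr_ge0 r); rewrite -/S.
  by rewrite -!exprM.
rewrite /step_poly /= !mul0r !add0r.
have -> : overshoot eps u v S = 48 / eps ^+ 3 * (q * S ^+ 2 + S ^+ 3).
  by rewrite /overshoot -/q; ring.
have -> : 144 / eps ^+ 3 * q * (l ^+ 4 + m ^+ 4 + r ^+ 4) +
    432 / eps ^+ 3 * (l ^+ 6 + m ^+ 6 + r ^+ 6) =
    48 / eps ^+ 3 * (q * (3 * (l ^+ 4 + m ^+ 4 + r ^+ 4)) +
                     9 * (l ^+ 6 + m ^+ 6 + r ^+ 6)) by ring.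
by rewrite ler_wpM2l// lerD// ler_wpM2l.
Qed.

(** The room for the overshoot is proportional to [c], which is [eps ^- 3] or,
where no overshoot has to be absorbed, [0]. *)
Definition step_bound (R : realType) (c e0 e1 e2 e3 e4 u v l m r : R) : R :=
  step_poly e0 e1 e2 e3 e4 (144 * c * (1 + u ^+ 2 + v ^+ 2)) (432 * c)
    u v l m r.

Lemma step_bound_ge (R : realType) (eps e0 e1 e2 e3 e4 u v l m r : R) :
  0 < eps ->
  step_bound 0 e0 e1 e2 e3 e4 u v l m r +
  overshoot eps u v (l ^+ 2 + m ^+ 2 + r ^+ 2) <=
  step_bound (eps ^- 3) e0 e1 e2 e3 e4 u v l m r.
Proof.
move=> eps0; have := overshoot_le_step_poly u v l m r eps0.
rewrite /step_bound /step_poly /= !mul0r !mulr0 !mul0r !add0r => h.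
by rewrite !addr0 -[leRHS]addrA lerD2l.
Qed.

Lemma sqr_step_le (R : realType) (l m r : R) :
  (m - l) ^+ 2 <= 2 * (l ^+ 2 + m ^+ 2 + r ^+ 2) /\
  (r - m) ^+ 2 <= 2 * (l ^+ 2 + m ^+ 2 + r ^+ 2).
Proof.
have h1 := sqr_ge0 (m + l); have h2 := sqr_ge0 (r + m).
by have h3 := sqr_ge0 l; have h4 := sqr_ge0 r; split; lra.
Qed.

(** * The killed walk *)

Definition quadrant (R : realType) (eps : R) : set (R * R) :=
  [set z | eps <= z.1 /\ eps <= z.2].

Lemma measurable_quadrant (R : realType) (eps : R) :
  measurable (quadrant eps).
Proof.
have -> : quadrant eps = `[eps, +oo[ `*` `[eps, +oo[.
  by apply/seteqP; split=> [z [h1 h2]|z []]; rewrite /= ?in_itv /= ?andbT.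
exact: measurableX.
Qed.

Section killed_walk.
Context (d : measure_display) (T : measurableType d) (R : realType)
  (xi : nat -> T -> R) (x y eps : R).

(** The increments of the left, middle and right particles during the [i]-th
step are [xi (3 i)], [xi (3 i + 1)] and [xi (3 i + 2)]. *)
Definition walk (k : nat) (w : T) : R * R :=
  (x + \sum_(i < k) (xi (3 * i).+1 w - xi (3 * i)%N w),
   y + \sum_(i < k) (xi (3 * i).+2 w - xi (3 * i).+1 w)).

(** The indicator of survival up to time [k] included. *)
Definition alive (k : nat) (w : T) : R :=
  \prod_(i < k.+1) \1_(quadrant eps) (walk i w).

Definition walk_next (z : (R * R) * R * R * R) : R * R :=
  let: (u, v, l, m, r) := z in (u + m - l, v + r - m).

Lemma walkS k w : walk k.+1 w =
  walk_next (walk k w, xi (3 * k)%N w, xi (3 * k).+1 w, xi (3 * k).+2 w).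
Proof. by rewrite /walk !big_ord_recr/=; congr (_, _); ring. Qed.

Lemma aliveS k w : alive k.+1 w = alive k w * \1_(quadrant eps) (walk k.+1 w).
Proof. by rewrite /alive big_ord_recr. Qed.

Lemma alive01 k w : alive k w = 0 \/
  alive k w = 1 /\ quadrant eps (walk k w).
Proof.
elim: k => [|k IH].
  rewrite /alive big_ord1 indicE.
  by case: (boolP (_ \in _)); rewrite ?inE; [right|left].
rewrite aliveS indicE; case: (boolP (_ \in _)) => [|_]; last by rewrite mulr0; left.
by rewrite inE mulr1 => qw; case: IH => [->|[-> _]]; [left|right].
Qed.

Hypothesis mxi : forall i, measurable_fun [set: T] (xi i).

Lemma measurable_walk k : measurable_fun [set: T] (walk k).
Proof.
apply/measurable_fun_pair; rewrite /walk /=.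
  apply: measurable_funD => //; apply: measurable_sum => i.
  exact: measurable_funB.
apply: measurable_funD => //; apply: measurable_sum => i.
exact: measurable_funB.
Qed.

Lemma measurable_alive k : measurable_fun [set: T] (alive k).
Proof.
apply: measurable_prod => i _; apply: measurableT_comp; last exact: measurable_walk.
apply: measurable_indic; exact: measurable_quadrant.
Qed.

End killed_walk.

Section walk_expectation.
Context (d : measure_display) (T : measurableType d) (R : realType)
  (P : probability T R) (xi : nat -> T -> R) (N : nat) (x y eps s : R).
Hypothesis mxi : forall i, measurable_fun [set: T] (xi i).
Hypothesis indxi : independent_sequence P xi (3 * N).
Hypothesis s0 : 0 < s.
Hypothesis lawxi : forall i, (i < 3 * N)%N -> forall B, measurable B ->
  P (xi i @^-1` B) = normal_prob 0 s B.

Let state (k : nat) (w : T) : R * R * R := (walk xi x y k w, alive xi x y eps k w).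

Let mstate k : measurable_fun [set: T] (state k).
Proof.
by apply/measurable_fun_pair; [exact: measurable_walk|exact: measurable_alive].
Qed.

Let i0 (k : nat) : (k < N)%N -> (3 * k < 3 * N)%N. Proof. lia. Qed.
Let i1 (k : nat) : (k < N)%N -> ((3 * k).+1 < 3 * N)%N. Proof. lia. Qed.
Let i2 (k : nat) : (k < N)%N -> ((3 * k).+2 < 3 * N)%N. Proof. lia. Qed.

Let m0 k : measurable_fun [set: T] (fun w => (state k w, xi (3 * k)%N w)).
Proof. exact/measurable_fun_pair. Qed.

Let m1 k : measurable_fun [set: T]
  (fun w => (state k w, xi (3 * k)%N w, xi (3 * k).+1 w)).
Proof. exact/measurable_fun_pair. Qed.

Let steps (z : R * R * R * R * R * R) : R * R * R * R * R :=
  (z.1.1.1.1, z.1.1.2, z.1.2, z.2).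

Let msteps : measurable_fun setT steps.
Proof.
apply/measurable_fun_pair; last exact: measurable_snd.
apply/measurable_fun_pair; last by apply: measurableT_comp.
apply/measurable_fun_pair; last first.
  by apply: measurableT_comp => //; apply: measurableT_comp.
do 3 (apply: measurableT_comp => //).
Qed.

Let mwalk_next : measurable_fun setT (@walk_next R).
Proof.
have -> : @walk_next R = fun z =>
    (z.1.1.1.1 + z.1.2 - z.1.1.2, z.1.1.1.2 + z.2 - z.1.2).
  by apply/funext => -[[[[u v] l] m] r].
have p4 : measurable_fun setT (fun z : R * R * R * R * R => z.1.1.1).
  by do 2 (apply: measurableT_comp => //).
have p3 : measurable_fun setT (fun z : R * R * R * R * R => z.1.1.2).
  by do 2 (apply: measurableT_comp => //).
have p2 : measurable_fun setT (fun z : R * R * R * R * R => z.1.2).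
  exact: measurableT_comp.
apply/measurable_fun_pair; apply: measurable_funB => //; apply: measurable_funD => //.
  exact: (measurableT_comp _ p4).
exact: (measurableT_comp _ p4).
Qed.

Let state_next (z : R * R * R * R * R * R) : R * R * R :=
  (walk_next (steps z),
   z.1.1.1.2 * \1_(quadrant eps) (walk_next (steps z))).

Let mstate_next : measurable_fun setT state_next.
Proof.
have mn : measurable_fun setT (@walk_next R \o steps).
  exact: measurableT_comp.
apply/measurable_fun_pair => //; apply: measurable_funM.
  by do 3 (apply: measurableT_comp => //).
apply: measurableT_comp mn; apply: measurable_indic; exact: measurable_quadrant.
Qed.

Let indstate k : (k <= N)%N ->
  independent_of_future P xi (3 * N) (state k) (3 * k).
Proof.
elim: k => [_|k IH kN].
  have -> : state 0 = fun=> (x, y, \1_(quadrant eps) (x, y)).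
    apply/funext => w; rewrite /state /alive big_ord1 /walk !big_ord0 !addr0.
    by [].
  exact: independent_of_future_cst.
have h0 := independent_of_future_pair mxi indxi (mstate k) (IH (ltnW kN)) (i0 kN).
have h1 := independent_of_future_pair mxi indxi (m0 k) h0 (i1 kN).
have h2 := independent_of_future_pair mxi indxi (m1 k) h1 (i2 kN).
have -> : state k.+1 = state_next \o
    (fun w => (state k w, xi (3 * k)%N w, xi (3 * k).+1 w, xi (3 * k).+2 w)).
  by apply/funext => w; rewrite /state /state_next /steps /= aliveS walkS.
rewrite (_ : 3 * k.+1 = (3 * k).+3)%N; last by lia.
exact: independent_of_future_comp h2.
Qed.

(** The Markov property of the killed walk. *)
Lemma integral_walk_step (k : nat) (F : R * R * R * R * R -> R) : (k < N)%N ->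
  measurable_fun setT F ->
  (forall u v l m r, quadrant eps (u, v) -> 0 <= F (u, v, l, m, r)) ->
  (\int[P]_w (alive xi x y eps k w *
     F (walk xi x y k w, xi (3 * k)%N w, xi (3 * k).+1 w, xi (3 * k).+2 w))%:E =
   \int[P]_w \int[normal_prob 0 s]_l \int[normal_prob 0 s]_m
     \int[normal_prob 0 s]_r
     (alive xi x y eps k w * F (walk xi x y k w, l, m, r))%:E)%E.
Proof.
move=> kN mF F0.
(* the absolute value makes [g2] nonnegative off the range of the state *)
pose g2 (z : R * R * R * R * R * R) : \bar R :=
  (`|z.1.1.1.2 * F (steps z)|)%:E.
have g2E w l m r : g2 (state k w, l, m, r) =
    (alive xi x y eps k w * F (walk xi x y k w, l, m, r))%:E.
  rewrite /g2 /steps /=; congr EFin; apply: ger0_norm.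
  have [->|[-> qw]] := alive01 xi x y eps k w; first by rewrite mul0r.
  by rewrite mul1r; move: qw; case: (walk _ _ _ _ _) => u v; exact: F0.
have mg2 : measurable_fun setT g2.
  apply/measurable_EFinP; apply: measurableT_comp => //.
  apply: measurable_funM; last exact: measurableT_comp.
  by do 3 (apply: measurableT_comp => //).
have g20 z : (0 <= g2 z)%E by rewrite lee_fin.
pose g1 z := (\int[normal_prob 0 s]_r g2 (z, r))%E.
have mg1 : measurable_fun setT g1.
  exact: (measurable_fun_fubini_tonelli_F (m2 := normal_prob 0 s) g2).
have g10 z : (0 <= g1 z)%E by exact: integral_ge0.
pose g0 z := (\int[normal_prob 0 s]_r g1 (z, r))%E.
have mg0 : measurable_fun setT g0.
  exact: (measurable_fun_fubini_tonelli_F (m2 := normal_prob 0 s) g1).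
have g00 z : (0 <= g0 z)%E by exact: integral_ge0.
have h0 := independent_of_future_pair mxi indxi (mstate k) (indstate (ltnW kN)) (i0 kN).
have h1 := independent_of_future_pair mxi indxi (m0 k) h0 (i1 kN).
pose nu : probability (measurableTypeR R) R := normal_prob 0 s.
have nuE i : (i < 3 * N)%N -> forall B, measurable B -> P (xi i @^-1` B) = nu B.
  exact: lawxi.
under eq_integral do rewrite -g2E.
rewrite (ge0_integral_freeze mxi indxi (m1 k) h1 (i2 kN) 
  (nuE _ (i2 kN)) mg2 g20).
transitivity (\int[P]_w g1 (state k w, xi (3 * k)%N w, xi (3 * k).+1 w))%E; first by [].
rewrite (ge0_integral_freeze mxi indxi (m0 k) h0 (i1 kN) 
  (nuE _ (i1 kN)) mg1 g10).
transitivity (\int[P]_w g0 (state k w, xi (3 * k)%N w))%E; first by [].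
rewrite (ge0_integral_freeze mxi indxi (mstate k) (indstate (ltnW kN)) (i0 kN) 
  (nuE _ (i0 kN)) mg0 g00).
apply: eq_integral => w _; apply: eq_integral => l _; apply: eq_integral => m _.
by apply: eq_integral => r _; rewrite g2E.
Qed.

End walk_expectation.

(** * Moments of the killed walk *)

Definition quad_poly (R : realType) (c0 c1 c2 c3 c4 : R) (z : R * R) : R :=
  c0 + c1 * (z.1 * z.2) + c2 * (z.1 * z.2 * (z.1 + z.2)) +
  c3 * (z.1 ^+ 2 + z.2 ^+ 2) + c4 * (z.1 + z.2).

Lemma measurable_quad_poly (R : realType) (c0 c1 c2 c3 c4 : R) :
  measurable_fun [set: R * R] (quad_poly c0 c1 c2 c3 c4).
Proof.
rewrite /quad_poly; apply: measurable_funD; last first.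
  by apply: measurable_funM => //; exact: measurable_funD.
apply: measurable_funD; last first.
  apply: measurable_funM => //.
  by apply: measurable_funD; exact: measurable_funX.
apply: measurable_funD; last first.
  apply: measurable_funM => //; apply: measurable_funM; first exact: measurable_funM.
  exact: measurable_funD.
apply: measurable_funD => //; apply: measurable_funM => //.
exact: measurable_funM.
Qed.

Section walk_moments.
Context (d : measure_display) (T : measurableType d) (R : realType)
  (P : probability T R) (xi : nat -> T -> R) (N : nat) (x y eps s : R).
Hypothesis mxi : forall i, measurable_fun [set: T] (xi i).
Hypothesis indxi : independent_sequence P xi (3 * N).
Hypothesis s0 : 0 < s.
Hypothesis lawxi : forall i, (i < 3 * N)%N -> forall B, measurable B ->
  P (xi i @^-1` B) = normal_prob 0 s B.

Let a k w := alive xi x y eps k w.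
Let Z k w := walk xi x y k w.

Let killed (f : R * R -> R) k (w : T) : \bar R := (a k w * f (Z k w))%:E.

Let mkilled (f : R * R -> R) k : measurable_fun [set: R * R] f ->
  measurable_fun [set: T] (killed f k).
Proof.
move=> mf; apply/measurable_EFinP; apply: measurable_funM.
  exact: measurable_alive.
by apply: measurableT_comp => //; exact: measurable_walk.
Qed.

Definition walk_mean (f : R * R -> R) (k : nat) : R :=
  fine (\int[P]_w (alive xi x y eps k w * f (walk xi x y k w))%:E)%E.

Let pk := walk_mean (fun=> 1).
Let hk := walk_mean (fun z => z.1 * z.2).
Let gk := walk_mean (fun z => z.1 * z.2 * (z.1 + z.2)).
Let rk := walk_mean (fun z => z.1 ^+ 2 + z.2 ^+ 2).
Let tk := walk_mean (fun z => z.1 + z.2).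

Let a_ge0 k w : 0 <= a k w.
Proof. by rewrite /a; have [->//|[->]] := alive01 xi x y eps k w. Qed.

Let killed_integrable (f g : R * R -> R) k : measurable_fun [set: R * R] f ->
  (forall z, `|f z| <= g z) ->
  P.-integrable [set: T] (killed g k) -> P.-integrable [set: T] (killed f k).
Proof.
move=> mf fg ig; apply: le_integrable ig => //; first exact: mkilled.
move=> w _; rewrite /killed !abse_EFin lee_fin !normrM ler_wpM2l//.
by rewrite (le_trans (fg _))// ler_norm.
Qed.

Let killed_integrableZ (f : R * R -> R) k (c : R) : P.-integrable [set: T] (killed f k) ->
  P.-integrable [set: T] (killed (fun z => c * f z) k).
Proof.
move=> ifk; rewrite (_ : killed _ k = fun w => (c%:E * killed f k w)%E).
  exact: integrableZl.
by apply/funext => w; rewrite /killed -EFinM mulrCA.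
Qed.

Let killed_integralZ (f : R * R -> R) k (c : R) : P.-integrable [set: T] (killed f k) ->
  (\int[P]_w killed (fun z => (c * f z)%R) k w = (c * walk_mean f k)%:E)%E.
Proof.
move=> ifk; rewrite (_ : killed _ k = fun w => (c%:E * killed f k w)%E).
  by rewrite integralZl// EFinM /walk_mean fineK// integrable_fin_num.
by apply/funext => w; rewrite /killed -EFinM mulrCA.
Qed.

Let killedD (f g : R * R -> R) k : killed (fun z => f z + g z) k = (killed f k \+ killed g k)%E.
Proof. by apply/funext => w; rewrite /killed -EFinD mulrDr. Qed.

Let basics_integrable k :=
  P.-integrable [set: T] (killed (fun z => 1 + z.1 ^+ 2 + z.2 ^+ 2) k) /\
  P.-integrable [set: T] (killed (fun z => z.1 * z.2 * (z.1 + z.2)) k).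

Let integral_quad_poly k (c0 c1 c2 c3 c4 : R) : basics_integrable k ->
  P.-integrable [set: T] (killed (quad_poly c0 c1 c2 c3 c4) k) /\
  (\int[P]_w killed (quad_poly c0 c1 c2 c3 c4) k w =
   (c0 * pk k + c1 * hk k + c2 * gk k + c3 * rk k + c4 * tk k)%:E)%E.
Proof.
move=> [iq ig].
have i0 : P.-integrable [set: T] (killed (fun=> 1) k).
  apply: killed_integrable iq => // z; rewrite normr1 -addrA lerDl.
  by rewrite addr_ge0 ?sqr_ge0.
have ih : P.-integrable [set: T] (killed (fun z => z.1 * z.2) k).
  apply: killed_integrable iq => [|z]; first exact: measurable_funM.
  have h1 := sqr_ge0 (z.1 + z.2); have h2 := sqr_ge0 (z.1 - z.2).
  have h3 := sqr_ge0 z.1; have h4 := sqr_ge0 z.2.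
  by rewrite ler_norml; apply/andP; split; lra.
have ir : P.-integrable [set: T] (killed (fun z => z.1 ^+ 2 + z.2 ^+ 2) k).
  apply: killed_integrable iq => [|z].
    by apply: measurable_funD; exact: measurable_funX.
  by rewrite ger0_norm ?addr_ge0 ?sqr_ge0// -addrA lerDr.
have it : P.-integrable [set: T] (killed (fun z => z.1 + z.2) k).
  apply: killed_integrable iq => [|z]; first exact: measurable_funD.
  have h1 := sqr_ge0 (z.1 - 1); have h2 := sqr_ge0 (z.2 - 1).
  have h3 := sqr_ge0 (z.1 + 1); have h4 := sqr_ge0 (z.2 + 1).
  have h5 := sqr_ge0 z.1; have h6 := sqr_ge0 z.2.
  by rewrite ler_norml; apply/andP; split; lra.
have j0 := killed_integrableZ c0 i0.
have jh := killed_integrableZ c1 ih.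
have jg := killed_integrableZ c2 ig.
have jr := killed_integrableZ c3 ir.
have jt := killed_integrableZ c4 it.
rewrite /quad_poly (_ : (fun z => _) = (fun z => c0 * 1 + c1 * (z.1 * z.2) +
  c2 * (z.1 * z.2 * (z.1 + z.2)) + c3 * (z.1 ^+ 2 + z.2 ^+ 2) +
  c4 * (z.1 + z.2))); last by apply/funext => z; rewrite mulr1.
rewrite !killedD; split; first by do 4 (apply: integrableD => //).
rewrite integralD//; last by do 3 (apply: integrableD => //).
rewrite integralD//; last by do 2 (apply: integrableD => //).
rewrite integralD//; last by do 1 (apply: integrableD => //).
by rewrite integralD// !killed_integralZ// -!EFinD.
Qed.

Let M4 := normal_moment s 4.
Let M6 := normal_moment s 6.

(** The expectation of the room left for the overshoot. *)
Let step_err (c : R) k := 432 * c * M4 * (pk k + rk k) + 1296 * c * M6 * pk k.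

Let killed_step (f : R * R * R * R * R -> R) k (w : T) : \bar R :=
  (a k w * f (Z k w, xi (3 * k)%N w, xi (3 * k).+1 w, xi (3 * k).+2 w))%:E.

Let bound_fun (c e0 e1 e2 e3 e4 : R) (z : R * R * R * R * R) : R :=
  step_bound c e0 e1 e2 e3 e4 z.1.1.1.1 z.1.1.1.2 z.1.1.2 z.1.2 z.2.

Let mbound c e0 e1 e2 e3 e4 : measurable_fun setT (bound_fun c e0 e1 e2 e3 e4).
Proof.
have mu : measurable_fun setT (fun z : R * R * R * R * R => z.1.1.1.1).
  by do 3 (apply: measurableT_comp => //).
have mv : measurable_fun setT (fun z : R * R * R * R * R => z.1.1.1.2).
  by do 3 (apply: measurableT_comp => //).
have ml : measurable_fun setT (fun z : R * R * R * R * R => z.1.1.2).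
  by do 2 (apply: measurableT_comp => //).
have mm : measurable_fun setT (fun z : R * R * R * R * R => z.1.2).
  exact: measurableT_comp.
have mr : measurable_fun setT (fun z : R * R * R * R * R => z.2).
  exact: measurable_snd.
have mu' : measurable_fun setT
    (fun z : R * R * R * R * R => z.1.1.1.1 + z.1.2 - z.1.1.2).
  by apply: measurable_funB => //; exact: measurable_funD.
have mv' : measurable_fun setT
    (fun z : R * R * R * R * R => z.1.1.1.2 + z.2 - z.1.2).
  by apply: measurable_funB => //; exact: measurable_funD.
have mX (f : R * R * R * R * R -> R) n : measurable_fun setT f ->
  measurable_fun setT (fun z : R * R * R * R * R => f z ^+ n : R).
  exact: measurable_funX.
rewrite /bound_fun /step_bound /step_poly /=.
apply: measurable_funD; last first.
  apply: measurable_funM => //; do ?apply: measurable_funD; exact: mX.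
apply: measurable_funD; last first.
  apply: measurable_funM; last by do ?apply: measurable_funD; exact: mX.
  by apply: measurable_funM => //; do ?apply: measurable_funD => //; exact: mX.
apply: measurable_funD; last first.
  by apply: measurable_funM => //; exact: measurable_funD.
apply: measurable_funD; last first.
  by apply: measurable_funM => //; apply: measurable_funD; exact: mX.
apply: measurable_funD; last first.
  apply: measurable_funM => //; apply: measurable_funM.
    exact: measurable_funM.
  exact: measurable_funD.
apply: measurable_funD => //; apply: measurable_funM => //.
exact: measurable_funM.
Qed.

Let mkilled_step (c e0 e1 e2 e3 e4 : R) k :
  measurable_fun [set: T] (killed_step (bound_fun c e0 e1 e2 e3 e4) k).
Proof.
apply/measurable_EFinP; apply: measurable_funM; first exact: measurable_alive.
apply: (measurableT_comp (mbound _ _ _ _ _ _)).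
do 3 (apply/measurable_fun_pair => //).
exact: measurable_walk.
Qed.

Let integral_step_bound k (c e0 e1 e2 e3 e4 : R) : (k < N)%N ->
  basics_integrable k ->
  (forall u v l m r, quadrant eps (u, v) ->
    0 <= step_bound c e0 e1 e2 e3 e4 u v l m r) ->
  (\int[P]_w killed_step (bound_fun c e0 e1 e2 e3 e4) k w =
   (e0 * pk k + e1 * (hk k - s ^+ 2 * pk k) + e2 * gk k +
    e3 * (rk k + 4 * s ^+ 2 * pk k) + e4 * tk k + step_err c k)%:E)%E.
Proof.
move=> kN bk sb0.
rewrite /killed_step (@integral_walk_step _ _ _ _ _ N _ _ _ s)//.
transitivity (\int[P]_w killed (quad_poly
    (e0 - e1 * s ^+ 2 + 4 * e3 * s ^+ 2 + 432 * c * M4 + 1296 * c * M6)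
    e1 e2 (e3 + 432 * c * M4) e4) k w)%E; last first.
  have [_ ->] := integral_quad_poly (e0 - e1 * s ^+ 2 + 4 * e3 * s ^+ 2 +
    432 * c * M4 + 1296 * c * M6) e1 e2 (e3 + 432 * c * M4) e4 bk.
  by congr EFin; rewrite /step_err; ring.
apply: eq_integral => w _; rewrite /killed /a /Z.
have [->|[-> _]] := alive01 xi x y eps k w.
  rewrite mul0r; under eq_integral => l _.
    under eq_integral => m _.
      under eq_integral do rewrite mul0r.
      rewrite integral0; over.
    rewrite integral0; over.
  by rewrite integral0.
under eq_integral => l _.
  under eq_integral => m _.
    by under eq_integral do rewrite mul1r; over.
  over.
case: (walk xi x y k w) => u v.
rewrite /bound_fun /step_bound /= integral_step_poly// mul1r; congr EFin.
rewrite /quad_poly -/M4 -/M6 /=; ring.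
Qed.

(** The drift inequality from which integrability and all upper bounds on the
moments follow by induction on time. *)
Let integral_step_le k (f : R * R -> R) (c e0 e1 e2 e3 e4 : R) : (k < N)%N ->
  basics_integrable k -> measurable_fun [set: R * R] f ->
  (forall z, quadrant eps z -> 0 <= f z) ->
  (forall u v l m r, quadrant eps (u, v) ->
    0 <= step_bound c e0 e1 e2 e3 e4 u v l m r /\
    (quadrant eps (u + m - l, v + r - m) ->
     f (u + m - l, v + r - m) <= step_bound c e0 e1 e2 e3 e4 u v l m r)) ->
  P.-integrable [set: T] (killed f k.+1) /\
  walk_mean f k.+1 <= e0 * pk k + e1 * (hk k - s ^+ 2 * pk k) + e2 * gk k +
    e3 * (rk k + 4 * s ^+ 2 * pk k) + e4 * tk k + step_err c k.
Proof.
move=> kN bk mf f0 H.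
have killed0 j w : (0 <= killed f j w)%E.
  rewrite lee_fin /a; have [->|[-> q]] := alive01 xi x y eps j w.
    by rewrite mul0r.
  by rewrite mul1r f0.
have sb0 u v l m r : quadrant eps (u, v) ->
    0 <= step_bound c e0 e1 e2 e3 e4 u v l m r.
  by move=> q; have [] := H u v l m r q.
have le : (\int[P]_w killed f k.+1 w <=
    \int[P]_w killed_step (bound_fun c e0 e1 e2 e3 e4) k w)%E.
  apply: ge0_le_integral => //.
  - exact: mkilled.
  - move=> w _; rewrite /killed /killed_step lee_fin /a /Z aliveS walkS.
    have [->|[-> q]] := alive01 xi x y eps k w; first by rewrite !mul0r.
    rewrite !mul1r; move: q; case: (walk xi x y k w) => u v q.
    have [h1 h2] := H u v (xi (3 * k)%N w) (xi (3 * k).+1 w) (xi (3 * k).+2 w) q.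
    rewrite /bound_fun /= indicE; case: (boolP (_ \in _)).
      by rewrite inE mul1r => /h2.
    by rewrite mul0r.
move: le; rewrite integral_step_bound// => le.
have fin : (\int[P]_w killed f k.+1 w)%E \is a fin_num.
  rewrite ge0_fin_numE ?integral_ge0//.
  by rewrite (le_lt_trans le)// ltry.
split.
  apply/integrableP; split; first exact: mkilled.
  under eq_integral => w _ do rewrite gee0_abs//.
  by rewrite -ge0_fin_numE ?integral_ge0.
by rewrite -lee_fin /walk_mean fineK.
Qed.

Hypothesis eps0 : 0 < eps.
Hypothesis eps1 : eps <= 1.
Hypothesis x_eps : eps <= x.
Hypothesis y_eps : eps <= y.

Let c := eps ^- 3.

Let overshoot_step0 u v l m r :
  0 <= overshoot eps u v (l ^+ 2 + m ^+ 2 + r ^+ 2).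
Proof. by apply: overshoot_ge0 => //; rewrite !addr_ge0 ?sqr_ge0. Qed.

Let step_prod_ge u v l m r : quadrant eps (u, v) ->
  0 <= step_bound c 0 1 0 0 0 u v l m r /\
  (u + m - l) * (v + r - m) <= step_bound c 0 1 0 0 0 u v l m r.
Proof.
move=> [/= ue ve]; have [h1 h2] := sqr_step_le l m r.
have h := step_bound_ge 0 1 0 0 0 u v l m r eps0.
have := prod_ge_overshoot eps0 ue ve h1 h2.
have := overshoot_step0 u v l m r.
move: h; rewrite -/c {1}/step_bound /step_poly /= => h h3 h4.
by split; move: h h3 h4; lra.
Qed.

Let step_cubic_ge u v l m r : quadrant eps (u, v) ->
  0 <= step_bound c 0 0 1 0 0 u v l m r /\
  (u + m - l) * (v + r - m) * (u + m - l + (v + r - m)) <=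
    step_bound c 0 0 1 0 0 u v l m r.
Proof.
move=> [/= ue ve]; have [h1 h2] := sqr_step_le l m r.
have h := step_bound_ge 0 0 1 0 0 u v l m r eps0.
have := cubic_ge_overshoot eps0 ue ve h1 h2.
have := overshoot_step0 u v l m r.
move: h; rewrite -/c {1}/step_bound /step_poly /= => h h3 h4.
by split; move: h h3 h4; lra.
Qed.

Let step_sqr_ge (u v l m r : R) :
  0 <= step_bound 0 1 0 0 1 0 u v l m r /\
  1 + (u + m - l) ^+ 2 + (v + r - m) ^+ 2 <= step_bound 0 1 0 0 1 0 u v l m r.
Proof.
rewrite /step_bound /step_poly /= !mul0r !mulr0 !mul0r !addr0 !mul1r.
by rewrite addrA; split => //; rewrite !addr_ge0 ?sqr_ge0.
Qed.

Let basicsS k : (k < N)%N -> basics_integrable k -> basics_integrable k.+1.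
Proof.
move=> kN bk; split.
  have [//|z _|u v l m r q|] := @integral_step_le k
    (fun z => 1 + z.1 ^+ 2 + z.2 ^+ 2) 0 1 0 0 1 0 kN bk.
  - by do ?apply: measurable_funD => //; exact: measurable_funX.
  - by rewrite !addr_ge0 ?sqr_ge0.
  - by have [] := step_sqr_ge u v l m r.
  - by [].
have [//|z [q1 q2]|u v l m r q|] := @integral_step_le k
    (fun z => z.1 * z.2 * (z.1 + z.2)) c 0 0 1 0 0 kN bk.
- apply: measurable_funM; first exact: measurable_funM.
  exact: measurable_funD.
- by rewrite !mulr_ge0 ?addr_ge0// (le_trans (ltW eps0)).
- by have [] := step_cubic_ge l m r q.
- by [].
Qed.

Let qxy : quadrant eps (x, y). Proof. by split. Qed.

Let killed_0 f w : killed f 0 w = (f (x, y))%:E.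
Proof.
rewrite /killed /a /Z /alive big_ord1 /walk !big_ord0 !addr0 indicE.
by rewrite mem_set ?mul1r.
Qed.

Let walk_mean0 f : walk_mean f 0 = f (x, y).
Proof.
rewrite /walk_mean (eq_integral (cst (f (x, y))%:E)).
  by rewrite integral_probability_cst.
by move=> w _; exact: killed_0.
Qed.

Let basics k : (k <= N)%N -> basics_integrable k.
Proof.
elim: k => [_|k IH kN]; last exact/basicsS/IH/ltnW.
have i0 f : P.-integrable [set: T] (killed f 0).
  rewrite (_ : killed f 0 = cst (f (x, y))%:E); last first.
    by apply/funext => w; exact: killed_0.
  exact: finite_measure_integrable_cst.
by split.
Qed.

Let walk_mean_quad_poly k (c0 c1 c2 c3 c4 : R) (f : R * R -> R) :
  (k <= N)%N -> f = quad_poly c0 c1 c2 c3 c4 ->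
  walk_mean f k = c0 * pk k + c1 * hk k + c2 * gk k + c3 * rk k + c4 * tk k.
Proof.
move=> kN ->.
by have [_ h] := integral_quad_poly c0 c1 c2 c3 c4 (basics kN); rewrite /walk_mean h.
Qed.

Let pk_le k : pk k.+1 <= pk k.
Proof.
rewrite /pk /walk_mean.
have fin j : (\int[P]_w killed (fun=> 1%R) j w)%E \is a fin_num.
  rewrite ge0_fin_numE; last first.
    by apply: integral_ge0 => w _; rewrite lee_fin mulr1.
  apply: (@le_lt_trans _ _ (\int[P]_w 1%R%:E))%E; last first.
    by rewrite integral_probability_cst ltry.
  apply: ge0_le_integral => //.
  - by move=> w _; rewrite lee_fin mulr1.
  - exact: mkilled.
  - move=> w _; rewrite lee_fin mulr1 /a.
    by have [->//|[->]] := alive01 xi x y eps j w.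
apply: fine_le; [exact: fin|exact: fin|apply: ge0_le_integral => //].
- by move=> w _; rewrite lee_fin mulr1.
- exact: (@mkilled (fun=> 1) k.+1).
- exact: (@mkilled (fun=> 1) k).
- by move=> w _; rewrite lee_fin !mulr1 aliveS ler_piMr.
Qed.

Let pk0 k : 0 <= pk k.
Proof.
rewrite /pk /walk_mean fine_ge0//; apply: integral_ge0 => w _.
by rewrite lee_fin mulr1.
Qed.

Let rk0 k : 0 <= rk k.
Proof.
rewrite /rk /walk_mean fine_ge0//; apply: integral_ge0 => w _.
by rewrite lee_fin mulr_ge0// addr_ge0 ?sqr_ge0.
Qed.

Let second_moment_step k : (k < N)%N ->
  pk k.+1 + rk k.+1 <= pk k + rk k + 4 * s ^+ 2 * pk k.
Proof.
move=> kN.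
have [//|z _|u v l m r q|_] := @integral_step_le k
    (fun z => 1 + z.1 ^+ 2 + z.2 ^+ 2) 0 1 0 0 1 0 kN (basics (ltnW kN)).
- by do ?apply: measurable_funD => //; exact: measurable_funX.
- by rewrite !addr_ge0 ?sqr_ge0.
- by have [] := step_sqr_ge u v l m r.
rewrite (@walk_mean_quad_poly k.+1 1 0 0 1 0)//; last first.
  by apply/funext => z; rewrite /quad_poly; ring.
by rewrite /step_err; lra.
Qed.

Let prod_step k : (k < N)%N ->
  hk k.+1 <= hk k - s ^+ 2 * pk k + step_err c k.
Proof.
move=> kN; have [//|z [q1 q2]|u v l m r q|_] := @integral_step_le k
    (fun z => z.1 * z.2) c 0 1 0 0 0 kN (basics (ltnW kN)).
- exact: measurable_funM.
- by rewrite mulr_ge0// (le_trans (ltW eps0)).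
- by have [] := step_prod_ge l m r q.
by rewrite -/(hk k.+1); lra.
Qed.

Let cubic_step k : (k < N)%N -> gk k.+1 <= gk k + step_err c k.
Proof.
move=> kN; have [//|z [q1 q2]|u v l m r q|_] := @integral_step_le k
    (fun z => z.1 * z.2 * (z.1 + z.2)) c 0 0 1 0 0 kN (basics (ltnW kN)).
- apply: measurable_funM; first exact: measurable_funM.
  exact: measurable_funD.
- by rewrite !mulr_ge0 ?addr_ge0// (le_trans (ltW eps0)).
- by have [] := step_cubic_ge l m r q.
by rewrite -/(gk k.+1); lra.
Qed.

Let shifted_prod_ge u v l m r : quadrant eps (u, v) ->
  let z := (u + m - l, v + r - m) in
  let b := step_bound c 0 (-1) 0 1 eps u v l m r in
  let q := step_bound 0 0 0 0 1 0 u v l m r in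
  [/\ 0 <= q, q <= b \/ quadrant eps z, 0 <= b &
      quadrant eps z -> q + eps * (z.1 + z.2) <= b + z.1 * z.2].
Proof.
move=> quv z b q; have [ue ve] : eps <= u /\ eps <= v by exact: quv.
have [h1 h2] := sqr_step_le l m r.
have := step_bound_ge 0 (-1) 0 1 eps u v l m r eps0; rewrite -/c -/b.
have qE : q = (u + m - l) ^+ 2 + (v + r - m) ^+ 2.
  by rewrite /q /step_bound /step_poly /=; ring.
have {1}-> : step_bound 0 0 (-1) 0 1 eps u v l m r =
    q - (u + m - l) * (v + r - m) + eps * (u + m - l + (v + r - m)).
  by rewrite qE /step_bound /step_poly /=; ring.
have W0 := overshoot_step0 u v l m r.
have q0 : 0 <= q by rewrite qE addr_ge0 ?sqr_ge0.
have [/andP[zu zv]|out] := boolP ((eps <= u + m - l) && (eps <= v + r - m)).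
  have pos : 0 <= eps * (u + m - l + (v + r - m)).
    by rewrite mulr_ge0 ?(ltW eps0)// addr_ge0// (le_trans (ltW eps0)).
  have := sqr_ge0 (u + m - l - (v + r - m)) => sq.
  have := sqr_ge0 (u + m - l + (v + r - m)) => sq'.
  move: W0 q0 pos sq sq'; rewrite /z /= => W0 q0 pos sq sq' h.
  split; [exact: q0|by right| |].
    by move: W0 q0 pos sq sq' h; rewrite qE; lra.
  by move=> _; move: W0 h; rewrite /=; lra.
have := @shifted_prod_le_overshoot R eps u v (m - l) (r - m) _ eps0 eps1 ue ve h1 h2.
rewrite !addrA => /(_ out) le h; move: le h => le h.
have qb : q <= b.
  move: le h; set W := overshoot _ _ _ _.
  by lra.
split; [exact: q0|by left|exact: le_trans qb|].
by move=> [/= zu zv]; move: out; rewrite zu zv.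
Qed.

(** The lower bound for the product is read off the shifted product
[u v - eps (u + v)]. Adding [u ^ 2 + v ^ 2], whose expectation after one step
is known exactly, keeps all the integrands nonnegative. *)
Let prod_step_ge k : (k < N)%N ->
  hk k + eps * tk k.+1 <= hk k.+1 + s ^+ 2 * pk k + eps * tk k + step_err c k.
Proof.
move=> kN; have bk := basics (ltnW kN).
pose A1 := killed_step (bound_fun 0 0 0 0 1 0) k.
pose A2 := killed (quad_poly 0 0 0 0 eps) k.+1.
pose B1 := killed_step (bound_fun c 0 (-1) 0 1 eps) k.
pose B2 := killed (quad_poly 0 1 0 0 0) k.+1.
have iA1 := @integral_step_bound k 0 0 0 0 1 0 kN bk.
have iB1 := @integral_step_bound k c 0 (-1) 0 1 eps kN bk.
have [_ iA2] := integral_quad_poly 0 0 0 0 eps (basics kN).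
have [_ iB2] := integral_quad_poly 0 1 0 0 0 (basics kN).
have qpos z : quadrant eps z -> 0 <= z.1 /\ 0 <= z.2.
  by move=> [z1 z2]; split; exact: le_trans (ltW eps0) _.
have step0 f w : (forall u v l m r, quadrant eps (u, v) -> 0 <= f (u, v, l, m, r)) ->
    (0 <= killed_step f k w)%E.
  move=> f0; rewrite lee_fin /a; have [->|[-> q]] := alive01 xi x y eps k w.
    by rewrite mul0r.
  by rewrite mul1r; move: q; rewrite /Z; case: (walk _ _ _ _ _) => u v; exact: f0.
have killed0 f j w : (forall z, quadrant eps z -> 0 <= f z) -> (0 <= killed f j w)%E.
  move=> f0; rewrite lee_fin /a; have [->|[-> q]] := alive01 xi x y eps j w.
    by rewrite mul0r.
  by rewrite mul1r f0.
have A10 w : (0 <= A1 w)%E.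
  by apply: step0 => u v l m r q; have [] := shifted_prod_ge l m r q.
have B10 w : (0 <= B1 w)%E.
  by apply: step0 => u v l m r q; have [] := shifted_prod_ge l m r q.
have A20 w : (0 <= A2 w)%E.
  apply: killed0 => z /qpos[z1 z2]; rewrite /quad_poly !mul0r !add0r.
  by rewrite mulr_ge0 ?addr_ge0// ltW.
have B20 w : (0 <= B2 w)%E.
  apply: killed0 => z /qpos[z1 z2]; rewrite /quad_poly !mul0r !addr0 add0r mul1r.
  exact: mulr_ge0.
have mA2 := mkilled k.+1 (measurable_quad_poly 0 0 0 0 eps).
have mB2 := mkilled k.+1 (measurable_quad_poly 0 1 0 0 0).
have : (\int[P]_w (A1 w + A2 w) <= \int[P]_w (B1 w + B2 w))%E.
  apply: ge0_le_integral => //.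
  - by move=> w _; rewrite adde_ge0.
  - by apply: emeasurable_funD => //; exact: mkilled_step.
  - by apply: emeasurable_funD => //; exact: mkilled_step.
  - move=> w _; rewrite /A1 /A2 /B1 /B2 /killed /killed_step -!EFinD lee_fin.
    rewrite /a /Z aliveS walkS.
    have [->|[-> q]] := alive01 xi x y eps k w; first by rewrite !mul0r.
    rewrite !mul1r; move: q; case: (walk xi x y k w) => u v q.
    have := shifted_prod_ge (xi (3 * k)%N w) (xi (3 * k).+1 w) (xi (3 * k).+2 w) q.
    move=> [h1 h2 h3 h4]; rewrite /bound_fun /= indicE.
    case: (boolP (_ \in _)) => [|h]; rewrite ?inE.
      move=> /[dup] hq /h4; rewrite !mul1r /quad_poly /=.
      by rewrite !mul0r !add0r !addr0 mul1r.
    rewrite !mul0r !addr0; case: h2 => // hq; move: h.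
    by rewrite notin_setE.
rewrite ge0_integralD//; [|exact: mkilled_step].
rewrite ge0_integralD//; [|exact: mkilled_step].
rewrite iA2 iB2 iA1 ?iB1; last 2 first.
- by move=> u v l m r q; have [] := shifted_prod_ge l m r q.
- by move=> u v l m r q; have [] := shifted_prod_ge l m r q.
rewrite -!EFinD lee_fin /step_err; lra.
Qed.

Let killed_mean_ge0 (f : R * R -> R) k :
  (forall z, quadrant eps z -> 0 <= f z) -> 0 <= walk_mean f k.
Proof.
move=> f0; rewrite /walk_mean fine_ge0//; apply: integral_ge0 => w _.
rewrite lee_fin; have [->|[-> q]] := alive01 xi x y eps k w.
  by rewrite mul0r.
by rewrite mul1r f0.
Qed.

Let qpos z : quadrant eps z -> 0 <= z.1 /\ 0 <= z.2.
Proof. by move=> [z1 z2]; split; exact: le_trans (ltW eps0) _. Qed.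

(** Pointwise, [u v <= K ^ 2] if [u + v <= K], and [u v <= u v (u + v) / K]
otherwise. *)
Let prod_le_cubic k K : (k <= N)%N -> 0 < K -> hk k <= K ^+ 2 * pk k + gk k / K.
Proof.
move=> kN K0; have bk := basics kN.
have [_ iA] := integral_quad_poly 0 1 0 0 0 bk.
have [_ iB] := integral_quad_poly (K ^+ 2) 0 K^-1 0 0 bk.
have : (\int[P]_w killed (quad_poly 0 1 0 0 0) k w <=
        \int[P]_w killed (quad_poly (K ^+ 2) 0 K^-1 0 0) k w)%E.
  apply: ge0_le_integral => //.
  - move=> w _; rewrite lee_fin /a; have [->|[-> /qpos[z1 z2]]] := alive01 xi x y eps k w.
      by rewrite mul0r.
    by rewrite mul1r /quad_poly !mul0r !addr0 add0r mul1r mulr_ge0.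
  - by apply: mkilled; exact: measurable_quad_poly.
  - by apply: mkilled; exact: measurable_quad_poly.
  - move=> w _; rewrite lee_fin /a; have [->|[-> /qpos]] := alive01 xi x y eps k w.
      by rewrite !mul0r.
    rewrite !mul1r /quad_poly !mul0r !addr0 add0r mul1r /Z.
    move: (walk xi x y k w).1 (walk xi x y k w).2 => u v [u0 v0].
    have uv0 : 0 <= u * v by exact: mulr_ge0.
    have [uvK|Kuv] := leP (u + v) K.
      apply: (@le_trans _ _ (K ^+ 2)); last first.
        by rewrite lerDl mulr_ge0 ?invr_ge0 ?(ltW K0)// mulr_ge0// addr_ge0.
      by rewrite expr2 ler_pM//; lra.
    apply: (@le_trans _ _ (K^-1 * (u * v * (u + v)))); last first.
      by rewrite lerDr sqr_ge0.
    by rewrite [leRHS]mulrC ler_pdivlMr// ler_wpM2l// ltW.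
by rewrite iA iB lee_fin => h; rewrite (mulrC (gk k)); move: h; lra.
Qed.

Hypothesis s1 : s <= 1.

Let sum_bound := 1 + x ^+ 2 + y ^+ 2 + 4 * (s ^+ 2 *+ N).

Let pk1 k : pk k <= 1.
Proof.
elim: k => [|k IH]; first by rewrite /pk walk_mean0.
exact: le_trans (pk_le k) IH.
Qed.

Let second_moment_le k : (k <= N)%N ->
  pk k + rk k <= 1 + x ^+ 2 + y ^+ 2 + 4 * (s ^+ 2 *+ k).
Proof.
elim: k => [_|k IH kN].
  by rewrite /pk /rk !walk_mean0 /= mulr0n mulr0 addr0 addrA.
have h1 := IH (ltnW kN); have h2 := second_moment_step kN.
have h3 : s ^+ 2 * pk k <= s ^+ 2 by rewrite ler_piMr ?sqr_ge0 ?pk1.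
by rewrite mulrSr; lra.
Qed.

Definition overshoot_err : R :=
  (432 * 64 + 1296 * 768) * eps ^- 3 * s ^+ 4 *
  (1 + x ^+ 2 + y ^+ 2 + 4 * (s ^+ 2 *+ N)).

Let step_err_le k : (k < N)%N -> step_err c k <= overshoot_err.
Proof.
move=> kN; have q1 := second_moment_le (ltnW kN).
have q2 : s ^+ 2 *+ k <= s ^+ 2 *+ N by rewrite ler_wpMn2l ?sqr_ge0// ltnW.
have q3 : pk k + rk k <= sum_bound by rewrite /sum_bound; lra.
have q4 : pk k <= sum_bound by have := rk0 k; lra.
have c0 : 0 <= c by rewrite /c invr_ge0 exprn_ge0// ltW.
have m4 : 0 <= M4 /\ M4 <= 64 * s ^+ 4.
  have h := normal_prob_moment4 s0; split.
    by rewrite /M4 /normal_moment fine_ge0// integral_ge0// => z _; rewrite lee_fin exprn_even_ge0.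
  rewrite -lee_fin /M4 /normal_moment fineK//.
  by apply: integrable_fin_num => //; exact: integrable_normal_prob_exprn.
have m6 : 0 <= M6 /\ M6 <= 768 * s ^+ 4.
  have h := normal_prob_moment6 s0; split.
    by rewrite /M6 /normal_moment fine_ge0// integral_ge0// => z _; rewrite lee_fin exprn_even_ge0.
  apply: (@le_trans _ _ (768 * s ^+ 6)); last first.
    by rewrite ler_wpM2l ?ler0n// ler_wiXn2l// ltW.
  rewrite -lee_fin /M6 /normal_moment fineK//.
  by apply: integrable_fin_num => //; exact: integrable_normal_prob_exprn.
have b4 : M4 * (pk k + rk k) <= 64 * s ^+ 4 * sum_bound.
  by apply: ler_pM => //; [exact: m4.1|exact: addr_ge0|exact: m4.2].
have b6 : M6 * pk k <= 768 * s ^+ 4 * sum_bound.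
  by apply: ler_pM => //; [exact: m6.1|exact: m6.2].
have h4 := ler_wpM2l c0 b4; have h6 := ler_wpM2l c0 b6.
rewrite /step_err /overshoot_err -/c -/sum_bound.
by move: h4 h6; lra.
Qed.

Let sum_pk n := \sum_(k < n) pk k.

Let sum_prod n : (n <= N)%N ->
  hk n + s ^+ 2 * sum_pk n <= x * y + overshoot_err *+ n.
Proof.
elim: n => [_|n IH nN].
  by rewrite /hk walk_mean0 /sum_pk big_ord0 mulr0n mulr0.
have h1 := IH (ltnW nN); have h2 := prod_step nN; have h3 := step_err_le nN.
by rewrite /sum_pk big_ord_recr/= -/(sum_pk n) mulrSr; lra.
Qed.

Let sum_cubic n : (n <= N)%N -> gk n <= x * y * (x + y) + overshoot_err *+ n.
Proof.
elim: n => [_|n IH nN]; first by rewrite /gk walk_mean0 mulr0n addr0.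
have h1 := IH (ltnW nN); have h2 := cubic_step nN; have h3 := step_err_le nN.
by rewrite mulrSr; lra.
Qed.

Let sum_prod_ge n : (n <= N)%N ->
  x * y + eps * tk n <=
  hk n + s ^+ 2 * sum_pk n + eps * (x + y) + overshoot_err *+ n.
Proof.
elim: n => [_|n IH nN].
  by rewrite /hk /tk !walk_mean0 /sum_pk big_ord0 /= mulr0n mulr0 !addr0.
have h1 := IH (ltnW nN); have h2 := prod_step_ge nN; have h3 := step_err_le nN.
by rewrite /sum_pk big_ord_recr/= -/(sum_pk n) mulrSr; lra.
Qed.

(** The decrease of the expected product pays for the time spent alive. *)
Lemma walk_survival_le :
  s ^+ 2 * (\sum_(k < N) walk_mean (fun=> 1) k) <= x * y + overshoot_err *+ N.
Proof.
have h := sum_prod (leqnn N); apply: le_trans h; rewrite lerDr.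
by apply: killed_mean_ge0 => z /qpos[z1 z2]; exact: mulr_ge0.
Qed.

(** At the horizon [t = N s ^ 2] the product is bounded through the probability
of survival, which is at most the expected survival time divided by [t], and
through the expectation of the cubic. *)
Lemma walk_survival_ge (K : R) : 0 < K -> (0 < N)%N ->
  x * y <= s ^+ 2 * (\sum_(k < N) walk_mean (fun=> 1) k) + eps * (x + y) +
    overshoot_err *+ N +
    K ^+ 2 * ((x * y + overshoot_err *+ N) / (s ^+ 2 *+ N)) +
    (x * y * (x + y) + overshoot_err *+ N) / K.
Proof.
move=> K0 N0.
have h1 := sum_prod_ge (leqnn N); have h2 := sum_cubic (leqnn N).
have h3 := prod_le_cubic (leqnn N) K0.
have t0 : 0 <= eps * tk N.
  rewrite mulr_ge0 ?(ltW eps0)//.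
  by apply: killed_mean_ge0 => z /qpos[z1 z2]; exact: addr_ge0.
have pN : pk N *+ N <= sum_pk N.
  have pmono k : (k <= N)%N -> pk N <= pk k.
    move=> kN; rewrite -(subnKC kN); elim: (N - k)%N => [|j IH]; first by rewrite addn0.
    by rewrite addnS (le_trans (pk_le _)).
  rewrite -[X in _ *+ X](card_ord N) -sumr_const; apply: ler_sum => i _.
  exact/pmono/ltnW.
have h4 : K ^+ 2 * pk N <= K ^+ 2 * ((x * y + overshoot_err *+ N) / (s ^+ 2 *+ N)).
  rewrite ler_wpM2l ?sqr_ge0// ler_pdivlMr ?pmulrn_lgt0 ?exprn_gt0//.
  have -> : pk N * (s ^+ 2 *+ N) = s ^+ 2 * (pk N *+ N) by rewrite !mulrnAr mulrC.
  rewrite (le_trans _ walk_survival_le)//.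
  by rewrite ler_wpM2l// sqr_ge0.
have h5 : gk N / K <= (x * y * (x + y) + overshoot_err *+ N) / K.
  by rewrite ler_wpM2r// invr_ge0 ltW.
by move: h1 h3 t0 h4 h5; rewrite -/(sum_pk N); lra.
Qed.

Lemma integral_sum_alive :
  (\int[P]_w (s ^+ 2 * \sum_(k < N) alive xi x y eps k w)%:E =
   (s ^+ 2 * (\sum_(k < N) walk_mean (fun=> 1) k))%:E)%E.
Proof.
under eq_integral do rewrite EFinM.
rewrite ge0_integralZl_EFin ?sqr_ge0//.
- rewrite [RHS]EFinM -sumEFin; congr (_ * _)%E.
  under eq_integral do rewrite -sumEFin.
  rewrite ge0_integral_sum//.
  + apply: eq_bigr => k _.
    have [_] := integral_quad_poly 1 0 0 0 0 (basics (ltnW (ltn_ord k))).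
    rewrite !mul0r !addr0 mul1r => <-; apply: eq_integral => w _.
    by rewrite /killed /quad_poly !mul0r !addr0 mulr1.
  + by move=> k; apply/measurable_EFinP; exact: measurable_alive.
  + by move=> k w _; rewrite lee_fin; exact: a_ge0.
- by move=> w _; rewrite lee_fin sumr_ge0// => k _; exact: a_ge0.
- apply/measurable_EFinP; apply: measurable_sum => k; exact: measurable_alive.
Qed.

End walk_moments.

(** * Increments of independent Brownian motions *)

Lemma independent_sequence_prod (d : measure_display) (T : measurableType d)
    (R : realType) (P : probability T R) (X : nat -> T -> R) (n : nat) :
  (forall E : nat -> set R, (forall i, measurable (E i)) ->
    P (future_event X E 0 n) = (\prod_(i < n) P (X i @^-1` E i))%E) ->
  independent_sequence P X n.
Proof.
move=> prodE.
have PE (E : nat -> set R) j : (forall i, measurable (E i)) -> (j <= n)%N ->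
    P (future_event X E j n) = (\prod_(j <= i < n) P (X i @^-1` E i))%E.
  move=> mE jn; pose E' i := if (i < j)%N then setT else E i.
  have mE' i : measurable (E' i) by rewrite /E'; case: ifP.
  have -> : future_event X E j n = future_event X E' 0 n.
    apply/seteqP; split=> w h i /=.
      move=> iN; rewrite /E'; case: ltnP => // ji.
      by apply: h; rewrite /= ji.
    move=> /andP[ji iN]; have := h i iN.
    by rewrite /preimage /E' /= ltnNge ji.
  rewrite prodE// -(big_mkord xpredT (fun i => P (X i @^-1` E' i))).
  rewrite (big_cat_nat (leq0n j) jn)/= big_nat big1 ?mul1e => [|i /andP[_ ij]].
    by apply: eq_big_nat => i /andP[ji _]; rewrite /E' ltnNge ji.
  by rewrite /E' ij preimage_setT probability_setT.
move=> E j mE jn; rewrite !PE// ?(ltnW jn)//.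
by rewrite big_ltn.
Qed.

Lemma prod_ord_mul3 (R : realType) (F : nat -> \bar R) (N : nat) :
  (\prod_(i < 3 * N) F i = \prod_(c < 3) \prod_(k < N) F (3 * k + c)%N)%E.
Proof.
elim: N => [|N IH].
  by rewrite muln0 big_ord0 big1// => c _; rewrite big_ord0.
rewrite mulnS addnC !addnS addn0 !big_ord_recr/= IH.
rewrite !big_ord_recr !big_ord0 /= !mul1e !addn0 addn1 addn2.
by rewrite [in RHS](muleACA _ (F (3 * N)%N)) [RHS]muleACA !muleA.
Qed.

Section brownian_increments.
Context (d : measure_display) (T : measurableType d) (R : realType)
  (P : probability T R).

(** The process is measurable for the sigma-algebra that it generates, hence so
are its increments. *)
Lemma increment_in_sigma_of_process (X : R -> T -> R) (n : nat)
    (t : nat -> R) (E : nat -> set R) : (forall k, 0 <= t k) ->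
  (forall k, measurable (E k)) ->
  sigma_of_process X
    (\bigcap_(k in [set k | (k < n)%N])
       (fun w => X (t k.+1) w - X (t k) w) @^-1` E k).
Proof.
move=> t0 mE; set G := \bigcup_(t in [set t : R | 0 <= t]) sigma_of (X t).
pose X' s : g_sigma_algebraType G -> R := X s.
have mX' s : 0 <= s -> measurable_fun [set: g_sigma_algebraType G] (X' s).
  move=> s0 _ A mA; apply: sub_sigma_algebra.
  by exists s => //; exists A.
have : measurable (\bigcap_(k in [set k | (k < n)%N])
    (fun w : g_sigma_algebraType G => X' (t k.+1) w - X' (t k) w) @^-1` E k).
  apply: bigcap_measurableType => k _; rewrite -[X in measurable X]setTI.
  by apply: measurable_funB => //; exact: mX'.
by [].
Qed.

Variables (B : 3.-tuple (R -> {RV P >-> R})) (s : R).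

Definition grid_increment (i : nat) (w : T) : R :=
  let X := tnth B (inord (i %% 3)) in
  let k := (i %/ 3)%N in
  X (k.+1%:R * s ^+ 2) w - X (k%:R * s ^+ 2) w.

Lemma measurable_grid_increment i : measurable_fun [set: T] (grid_increment i).
Proof. exact: measurable_funB. Qed.

Hypothesis s0 : 0 < s.
Hypothesis hB : forall c, exists a, standard_brownian_motion a (tnth B c).
Hypothesis indB : independent_processes B.

Lemma grid_increment_law i (A : set R) : measurable A ->
  P (grid_increment i @^-1` A) = normal_prob 0 s A.
Proof.
move=> mA; have [a hBa] := hB (inord (i %% 3)).
have s2 : 0 < s ^+ 2 by rewrite exprn_gt0.
set k := (i %/ 3)%N.
have k0 : 0 <= k%:R * s ^+ 2 by rewrite mulr_ge0// ltW.
have kk : k%:R * s ^+ 2 < k.+1%:R * s ^+ 2 by rewrite ltr_pM2r// ltr_nat.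
have -> : s = Num.sqrt (k.+1%:R * s ^+ 2 - k%:R * s ^+ 2).
  by rewrite -mulrBl -natrB// subSnn mul1r sqrtr_sqr gtr0_norm.
have <- := sbm_gaussian_increments hBa k0 kk mA.
by [].
Qed.

(** Independence of the processes separates the three particles, independence of
the increments of each process then separates the steps. *)
Lemma grid_increment_indep N : independent_sequence P grid_increment (3 * N).
Proof.
have s2 : 0 <= s ^+ 2 by rewrite sqr_ge0.
apply: independent_sequence_prod => E mE.
pose t (k : nat) : R := k%:R * s ^+ 2.
pose incr (c : 'I_3) k w := tnth B c (t k.+1) w - tnth B c (t k) w.
have incrE (c : 'I_3) k : grid_increment (3 * k + c) = incr c k.
  rewrite /grid_increment mulnC modnMDl divnMDl// modn_small// divn_small// addn0.
  by rewrite inord_val.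
pose G (c : 'I_3) := \bigcap_(k in [set k | (k < N)%N]) incr c k @^-1` E (3 * k + c)%N.
have GE : future_event grid_increment E 0 (3 * N) =
    \bigcap_(c in [set` [set: 'I_3]%SET]) G c.
  apply/seteqP; split=> w h.
    move=> c _ k /= kN; have := h (3 * k + c)%N.
    by rewrite /preimage /= incrE; apply; have := ltn_ord c; lia.
  move=> i /= iN; have im : (i %% 3 < 3)%N by rewrite ltn_mod.
  have := h (Ordinal im); rewrite /= inE => /(_ isT (i %/ 3)%N).
  rewrite /preimage /= -incrE /= mulnC -divn_eq; apply.
  by lia.
rewrite GE indB; last first.
  move=> c _; apply: increment_in_sigma_of_process => //.
  by move=> k; rewrite mulr_ge0.
rewrite (prod_ord_mul3 (fun i => P (grid_increment i @^-1` E i)) N).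
apply: eq_big => [c|c _]; first by rewrite inE.
have [a hBa] := hB c.
have tmono : {homo t : i j / (i <= j)%N >-> i <= j}.
  by move=> i j ij; rewrite ler_wpM2r// ler_nat.
have := sbm_indep_increments hBa (n := N) (t := t).
move=> /(_ _ tmono [set: 'I_N]%SET (fun k => incr c k @^-1` E (3 * k + c)%N)).
rewrite {1}/t mul0r => /(_ (lexx 0)).
have -> : \bigcap_(i in [set` [set: 'I_N]%SET]) incr c i @^-1` E (3 * i + c)%N = G c.
  apply/seteqP; split=> w h k /=.
    by move=> kN; apply: (h (Ordinal kN)); rewrite /= inE.
  by move=> _; apply: h => /=.
move=> ->; last by move=> k _; exists (E (3 * k + c)%N) => //; rewrite setTI.
by apply: eq_big => [k|k _]; [rewrite inE|rewrite incrE].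
Qed.

End brownian_increments.

(** * Lower limits and monotonicity of the integral *)

Section limn_einf_bounds.
Context (R : realType).
Implicit Types (u : nat -> \bar R).

Lemma limn_einfE_sup u : limn_einf u = ereal_sup (range (einfs u)).
Proof. by rewrite limn_einf_lim; apply/cvg_lim => //; exact: cvg_einfs_sup. Qed.

Lemma le_limn_einf u (l : \bar R) (n : nat) :
  (forall k, (n <= k)%N -> (l <= u k)%E) -> (l <= limn_einf u)%E.
Proof.
move=> lu; rewrite limn_einfE_sup; apply: (@le_trans _ _ (einfs u n)).
  by apply: le_ereal_inf_tmp => _ [k /= nk <-]; exact: lu.
by apply: ereal_sup_ubound; exists n.
Qed.

Lemma limn_einf_le_harmonic u (l C : R) :
  (forall k, (u k <= (l + C / k.+1%:R)%:E)%E) -> (limn_einf u <= l%:E)%E.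
Proof.
move=> ul; rewrite limn_einfE_sup; apply: ge_ereal_sup => _ [n _ <-].
have le k : (n <= k)%N -> (einfs u n <= (l + C / k.+1%:R)%:E)%E.
  by move=> nk; apply: le_trans (ul k); apply: ereal_inf_lbound; exists k.
have [C0|C0] := leP C 0.
  apply: le_trans (le n (leqnn n)) _.
  by rewrite lee_fin gerDl mulr_le0_ge0// invr_ge0.
apply/lee_addgt0Pr => e e0.
pose k := maxn n (Num.truncn (C / e)).
apply: le_trans (le k (leq_maxl _ _)) _.
rewrite -EFinD lee_fin lerD2l ler_pdivrMr// mulrC -ler_pdivrMr//.
have Ce : 0 <= C / e by rewrite divr_ge0// ltW.
have /andP[_ /ltW h] := truncn_itv Ce.
by rewrite (le_trans h)// ler_nat ltnS leq_maxr.
Qed.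

End limn_einf_bounds.

Section integral_monotonicity.
Import HBNNSimple.

(** Monotonicity of the integral does not depend on measurability, the integral
of a nonnegative function being the supremum of those of the simple functions
below it. This gives bounds for the expected collision time, which need not be
measurable: paths are continuous only outside a negligible set. *)
Lemma ge0_le_integral_ae (d : measure_display) (T : measurableType d)
    (R : realType) (mu : {measure set T -> \bar R}) (f g : T -> \bar R) :
  (forall w, 0 <= f w)%E -> (forall w, 0 <= g w)%E ->
  {ae mu, forall w, (f w <= g w)%E} ->
  (\int[mu]_w f w <= \int[mu]_w g w)%E.
Proof.
move=> f0 g0 [A [mA A0 fgA]].
rewrite (ge0_integralTE _ f0) (ge0_integralTE _ g0).
apply: ge_ereal_sup => _ [h hf <-].
pose h' := proj_nnsfun h (measurableC mA).
have -> : sintegral mu h = sintegral mu h'.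
  rewrite -!integralT_nnsfun; apply: ge0_ae_eq_integral => //.
  - exact/measurable_EFinP.
  - exact/measurable_EFinP.
  - by move=> w _; rewrite lee_fin.
  - by move=> w _; rewrite lee_fin.
  exists A; split => // w /= hw; apply: contrapT => Aw; apply: hw => _.
  by rewrite /= mindicE mem_set// mulr1.
apply: ereal_sup_ubound; exists h' => // w /=.
rewrite mindicE.
have [Aw|Aw] := pselect (A w).
  by rewrite memNset ?mulr0//=; apply/not_notP.
rewrite mem_set// mulr1 (le_trans (hf w))//.
by apply: contrapT => nfg; apply: Aw; exact: fgA.
Qed.

End integral_monotonicity.

(** * Survival on a grid along a continuous path *)

Section path.
Context (R : realType) (F G : R -> R).
Hypothesis cF : {within `[0, +oo[, continuous F}.
Hypothesis cG : {within `[0, +oo[, continuous G}.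
Hypothesis F0 : 0 < F 0.
Hypothesis G0 : 0 < G 0.

Let tau : \bar R :=
  ereal_inf [set t%:E | t in [set t : R | 0 < t /\ F t * G t = 0]].

Definition grid_alive (eps dt : R) (k : nat) : R :=
  \prod_(i < k.+1) \1_(quadrant eps) (F (i%:R * dt), G (i%:R * dt)).

Lemma grid_alive_ge0 eps dt k : 0 <= grid_alive eps dt k.
Proof. by apply: prodr_ge0 => i _; rewrite indicE. Qed.

Lemma grid_alive_le1 eps dt k : grid_alive eps dt k <= 1.
Proof. by apply: prodr_ile1 => i _; rewrite indicE; case: (_ \in _); rewrite ?lexx ?ler01. Qed.

Let within_itv (H : R -> R) (s : R) : {within `[0, +oo[, continuous H} ->
  {within `[0, s], continuous H}.
Proof.
move=> cH; apply: continuous_subspaceW cH => t /=.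
by rewrite !in_itv /= andbT => /andP[].
Qed.

Let pos_of_nonzero (H : R -> R) (s : R) : {within `[0, +oo[, continuous H} ->
  0 < H 0 -> (forall t, 0 < t -> t <= s -> H t != 0) ->
  forall t, 0 <= t -> t <= s -> 0 < H t.
Proof.
move=> cH H0 nz t t0 ts; rewrite ltNge; apply/negP => Ht.
have [|u] := @IVT R H 0 t 0 t0 (within_itv (s:=t) cH).
  by rewrite ge_min Ht orbT/= le_max (ltW H0).
rewrite in_itv /= => /andP[u0 ut] Hu.
have u_gt0 : 0 < u.
  by rewrite lt_neqAle u0 andbT; apply/eqP => u00; move: H0; rewrite {2}u00 Hu ltxx.
by have := nz u u_gt0 (le_trans ut ts); rewrite Hu eqxx.
Qed.

(** Up to time [s] both gaps stay positive, hence above their minimum [m]: no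
grid with a threshold below [m] kills the path before [s]. *)
Lemma grid_alive_before_collision (s : R) : 0 <= s -> (s%:E < tau)%E ->
  exists2 m, 0 < m & forall eps dt n, eps <= m -> 0 < dt ->
    Num.min s (dt *+ n) <= dt * \sum_(k < n) grid_alive eps dt k.
Proof.
move=> s0 stau.
have nz t : 0 < t -> t <= s -> F t * G t != 0.
  move=> t0 ts; apply/eqP => FG.
  have : (tau <= t%:E)%E by apply: ereal_inf_lbound; exists t.
  by move=> /(lt_le_trans stau); rewrite lte_fin ltNge ts.
have nzF t : 0 < t -> t <= s -> F t != 0.
  by move=> t0 ts; have := nz t t0 ts; rewrite mulf_eq0 negb_or => /andP[].
have nzG t : 0 < t -> t <= s -> G t != 0.
  by move=> t0 ts; have := nz t t0 ts; rewrite mulf_eq0 negb_or => /andP[].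
have Fpos := pos_of_nonzero cF F0 nzF.
have Gpos := pos_of_nonzero cG G0 nzG.
have [a] := EVT_min s0 (within_itv (s:=s) cF).
rewrite in_itv /= => /andP[a0 as_] Fa.
have [b] := EVT_min s0 (within_itv (s:=s) cG).
rewrite in_itv /= => /andP[b0 bs] Gb.
exists (Num.min (F a) (G b)).
  by rewrite lt_min Fpos ?Gpos.
move=> eps dt n; rewrite le_min => /andP[epsF epsG] dt0.
have alive1 k : k%:R * dt <= s -> grid_alive eps dt k = 1.
  move=> ks; apply: big1 => i _; rewrite indicE mem_set//=.
  have i0 : 0 <= i%:R * dt by rewrite mulr_ge0// ltW.
  have is_ : i%:R * dt <= s.
    by rewrite (le_trans _ ks)// ler_wpM2r ?(ltW dt0)// ler_nat -ltnS ltn_ord.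
  have it : i%:R * dt \in `[0, s] by rewrite in_itv /= i0.
  by split => /=; [exact: le_trans (Fa _ it)|exact: le_trans (Gb _ it)].
elim: n => [|n IH]; first by rewrite big_ord0 mulr0 mulr0n ge_min lexx orbT.
rewrite big_ord_recr /= mulrDr mulrSr.
have [ns|sn] := leP (n%:R * dt) s.
  rewrite alive1// mulr1; move: IH; rewrite -[dt *+ n]mulr_natl.
  rewrite (min_idPr ns) => IH.
  by rewrite ge_min; apply/orP; right; rewrite lerD2r.
move: IH; rewrite -[dt *+ n]mulr_natl (min_idPl (ltW sn)) => IH.
by rewrite ge_min (le_trans IH)// lerDl mulr_ge0 ?(ltW dt0)// grid_alive_ge0.
Qed.

(** A gap that vanishes is below [eps] for a while after that, so that a fine
grid has a point at which the path is killed. *)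
Lemma grid_alive_after_collision (s eps : R) : (tau < s%:E)%E -> 0 < eps ->
  exists2 eta, 0 < eta & forall dt n, 0 < dt -> dt < eta ->
    dt * \sum_(k < n) grid_alive eps dt k <= s.
Proof.
move=> /ereal_inf_lt[_ [t [t0 FG] <-]]; rewrite lte_fin => ts eps0.
have near_out : exists2 eta, 0 < eta & forall r, t <= r -> r < t + eta ->
    ~ quadrant eps (F r, G r).
  have cont (H : R -> R) : {within `[0, +oo[, continuous H} -> H t = 0 ->
      exists2 eta, 0 < eta & forall r, t <= r -> r < t + eta -> H r < eps.
    move=> cH Ht.
    have ct : {for t, continuous H}.
      have : {within `]0, +oo[, continuous H}.
        apply: continuous_subspaceW cH => r /=.
        by rewrite !in_itv /= !andbT => /ltW.
      rewrite continuous_open_subspace; last exact: interval_open.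
      by apply; rewrite inE /= in_itv /= t0.
    have /cvgrPdist_lt /(_ _ eps0) := ct.
    rewrite Ht => /nbhs_ballP[eta /= eta0 etaP].
    exists eta => // r tr rt.
    have := etaP r; rewrite /ball /= => /(_ _).
    rewrite sub0r normrN => h; apply: le_lt_trans (ler_norm _) _; apply: h.
    by rewrite distrC ger0_norm ?subr_ge0// ltrBlDl.
  move: FG => /eqP; rewrite mulf_eq0 => /orP[/eqP Ft|/eqP Gt].
    have [eta eta0 h] := cont F cF Ft; exists eta => // r tr rt [/= Fr _].
    by have := h r tr rt; rewrite ltNge Fr.
  have [eta eta0 h] := cont G cG Gt; exists eta => // r tr rt [/= _ Gr].
  by have := h r tr rt; rewrite ltNge Gr.
have [eta eta0 etaP] := near_out.
exists (Num.min eta (s - t)); first by rewrite lt_min eta0 subr_gt0.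
move=> dt n dt0; rewrite lt_min => /andP[dteta dts].
pose j := (Num.truncn (t / dt)).+1.
have tdt : 0 <= t / dt by rewrite divr_ge0// ltW.
have /andP[j1 j2] := truncn_itv tdt.
have tj : t <= j%:R * dt by rewrite -ler_pdivrMr// ltW.
have jt : j%:R * dt <= t + dt.
  by rewrite /j -natr1 mulrDl mul1r lerD2r -ler_pdivlMr.
have dead k : (j <= k)%N -> grid_alive eps dt k = 0.
  move=> jk; have jk1 : (j < k.+1)%N by [].
  rewrite /grid_alive (bigD1 (Ordinal jk1))//= indicE memNset ?mul0r//.
  by apply: etaP => //; rewrite (le_lt_trans jt)// ltrD2l.
have sum_le m : \sum_(k < m) grid_alive eps dt k <= (minn m j)%:R.
  elim: m => [|m IH]; first by rewrite big_ord0.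
  rewrite big_ord_recr /=; have [mj|jm] := ltnP m j.
    rewrite (minn_idPl mj) -natr1 lerD ?grid_alive_le1//.
    by rewrite (le_trans IH)// ler_nat geq_minl.
  rewrite dead// addr0 (le_trans IH)// ler_nat.
  by rewrite (minn_idPr jm) (minn_idPr (leqW jm)).
apply: (@le_trans _ _ (t + dt)); last by move: dts; lra.
rewrite (le_trans _ jt)// mulrC ler_wpM2r ?(ltW dt0)//.
by rewrite (le_trans (sum_le n))// ler_nat geq_minr.
Qed.

End path.

(** * The expected collision time *)

Lemma lee_from_below (R : realType) (a b : \bar R) : (0 <= b)%E ->
  (forall s : R, 0 <= s -> (s%:E < a)%E -> (s%:E <= b)%E) -> (a <= b)%E.
Proof.
case: b => [b| |]//; rewrite ?leey// lee_fin => b0 ab.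
rewrite leNgt; apply/negP; case: a ab => [a| |]// ab.
  rewrite lte_fin => ba; have := ab ((a + b) / 2).
  by rewrite lte_fin lee_fin => /(_ ltac:(lra) ltac:(lra)); lra.
move=> _; have := ab (b + 1).
by rewrite ltry lee_fin => /(_ ltac:(lra) isT); lra.
Qed.

Lemma lee_from_above (R : realType) (a b : \bar R) : (0 <= b)%E ->
  (forall s : R, (b < s%:E)%E -> (a <= s%:E)%E) -> (a <= b)%E.
Proof.
case: b => [b| |]//; rewrite ?leey// => _ ab.
by apply/lee_addgt0Pr => e e0; rewrite -EFinD; apply: ab; rewrite lte_fin ltrDl.
Qed.

Section collision.
Context (d : measure_display) (T : measurableType d) (R : realType)
  (P : probability T R) (x y : R) (BL BM BR : R -> {RV P >-> R}).
Hypothesis x0 : 0 < x.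
Hypothesis y0 : 0 < y.
Hypothesis hBL : standard_brownian_motion (- x) BL.
Hypothesis hBM : standard_brownian_motion 0 BM.
Hypothesis hBR : standard_brownian_motion y BR.
Hypothesis indB : independent_processes [tuple BL; BM; BR].

Let B := [tuple BL; BM; BR].
Let gapL (w : T) (t : R) : R := BM t w - BL t w.
Let gapR (w : T) (t : R) : R := BR t w - BM t w.
Let tau := collision_time BL BM BR.

Let good (w : T) := [/\ {within `[0, +oo[, continuous (gapL w)},
  {within `[0, +oo[, continuous (gapR w)}, gapL w 0 = x & gapR w 0 = y].

Let ae_good : {ae P, forall w, good w}.
Proof.
have sL := sbm_start hBL; have sM := sbm_start hBM; have sR := sbm_start hBR.
have cL := sbm_continuous hBL; have cM := sbm_continuous hBM.
have cR := sbm_continuous hBR.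
have aeI := @filterI _ (almost_everywhere P) (ae_filter_ringOfSetsType P).
have c3 := aeI _ _ (aeI _ _ cL cM) cR; have s3 := aeI _ _ (aeI _ _ sL sM) sR.
apply: filterS2 c3 s3 => w [[cLw cMw] cRw] [[sLw sMw] sRw]; split.
- by move=> t; apply: cvgB; [exact: cMw|exact: cLw].
- by move=> t; apply: cvgB; [exact: cRw|exact: cMw].
- by rewrite /gapL sLw sMw opprK add0r.
- by rewrite /gapR sRw sMw subr0.
Qed.

Let xi (s : R) := grid_increment B s.

Let mxi s i : measurable_fun [set: T] (xi s i).
Proof. exact: measurable_grid_increment. Qed.

Let sbm_all c : exists a, standard_brownian_motion a (tnth B c).
Proof.
case: c => [[|[|[|//]]] i]; [exists (- x)|exists 0|exists y];
  by rewrite (tnth_nth BL).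
Qed.

Let walk_gap s k w : good w ->
  walk (xi s) x y k w = (gapL w (k%:R * s ^+ 2), gapR w (k%:R * s ^+ 2)).
Proof.
move=> [_ _ gL gR].
have E0 i : xi s (3 * i)%N w = BL (i.+1%:R * s ^+ 2) w - BL (i%:R * s ^+ 2) w.
  rewrite /xi /grid_increment mulnC modnMl mulnK// (tnth_nth BL) inordK//.
have E1 i : xi s (3 * i).+1 w = BM (i.+1%:R * s ^+ 2) w - BM (i%:R * s ^+ 2) w.
  have -> : (3 * i).+1 = (i * 3 + 1)%N by lia.
  by rewrite /xi /grid_increment modnMDl divnMDl// addn0 (tnth_nth BL) inordK.
have E2 i : xi s (3 * i).+2 w = BR (i.+1%:R * s ^+ 2) w - BR (i%:R * s ^+ 2) w.
  have -> : (3 * i).+2 = (i * 3 + 2)%N by lia.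
  by rewrite /xi /grid_increment modnMDl divnMDl// addn0 (tnth_nth BL) inordK.
elim: k => [|k IH]; first by rewrite /walk !big_ord0 !addr0 mul0r gL gR.
by rewrite walkS IH /walk_next E0 E1 E2 /gapL /gapR; congr (_, _); ring.
Qed.

Let rho eps s N (w : T) : R := s ^+ 2 * \sum_(k < N) alive (xi s) x y eps k w.

Let rho_grid eps s N w : good w -> rho eps s N w =
  s ^+ 2 * \sum_(k < N) grid_alive (gapL w) (gapR w) eps (s ^+ 2) k.
Proof.
move=> gw; congr (_ * _); apply: eq_bigr => k _; apply: eq_bigr => i _.
by rewrite walk_gap.
Qed.

Let mrho eps s N : measurable_fun [set: T] (rho eps s N).
Proof.
apply: measurable_funM => //; apply: measurable_sum => k.
exact: measurable_alive.
Qed.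

Let rho_ge0 eps s N w : 0 <= rho eps s N w.
Proof.
rewrite mulr_ge0 ?sqr_ge0// sumr_ge0// => k _; apply: prodr_ge0 => i _.
by rewrite indicE.
Qed.

Let rho_le eps s N w : rho eps s N w <= s ^+ 2 *+ N.
Proof.
rewrite /rho -mulr_natr ler_wpM2l ?sqr_ge0//.
rewrite -[leRHS](_ : \sum_(k < N) 1 = _); last by rewrite sumr_const card_ord.
apply: ler_sum => k _; apply: prodr_ile1 => i _; rewrite indicE.
by case: (_ \in _); rewrite ?lexx ?ler01.
Qed.

Let tau_ge0 w : (0 <= tau w)%E.
Proof. by apply: le_ereal_inf_tmp => _ [t [t0 _] <-]; rewrite lee_fin ltW. Qed.

Let C0 : R := 432 * 64 + 1296 * 768.

Let C0_ge0 : 0 <= C0.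
Proof. by rewrite /C0 addr_ge0 ?mulr_ge0 ?ler0n. Qed.

Let overshoot_errE eps s N : overshoot_err N x y eps s =
  C0 * eps ^- 3 * s ^+ 4 * (1 + x ^+ 2 + y ^+ 2 + 4 * (s ^+ 2 *+ N)).
Proof. by []. Qed.

Let expectation_rho_le eps s N : 0 < s -> s <= 1 -> 0 < eps -> eps <= 1 ->
  eps <= x -> eps <= y ->
  (\int[P]_w (rho eps s N w)%:E <= (x * y + overshoot_err N x y eps s *+ N)%:E)%E.
Proof.
move=> s0 s1 eps0 eps1 epsx epsy.
have ind : independent_sequence P (xi s) (3 * N).
  by apply: grid_increment_indep => //; exact: sbm_all.
have law i : (i < 3 * N)%N -> forall A, measurable A ->
    P (xi s i @^-1` A) = normal_prob 0 s A.
  by move=> _ A mA; apply: grid_increment_law => //; exact: sbm_all.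
rewrite /rho (integral_sum_alive (N := N))// lee_fin.
exact: (walk_survival_le (N := N)).
Qed.

Let expectation_rho_ge eps s N K : 0 < s -> s <= 1 -> 0 < eps -> eps <= 1 ->
  eps <= x -> eps <= y -> 0 < K -> (0 < N)%N ->
  ((x * y - (eps * (x + y) +
    overshoot_err N x y eps s *+ N +
    K ^+ 2 * ((x * y + overshoot_err N x y eps s *+ N) / (s ^+ 2 *+ N)) +
    (x * y * (x + y) + overshoot_err N x y eps s *+ N) / K))%:E
    <= \int[P]_w (rho eps s N w)%:E)%E.
Proof.
move=> s0 s1 eps0 eps1 epsx epsy K0 N0.
have ind : independent_sequence P (xi s) (3 * N).
  by apply: grid_increment_indep => //; exact: sbm_all.
have law i : (i < 3 * N)%N -> forall A, measurable A ->
    P (xi s i @^-1` A) = normal_prob 0 s A.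
  by move=> _ A mA; apply: grid_increment_law => //; exact: sbm_all.
rewrite /rho (integral_sum_alive (N := N))// lee_fin.
have := @walk_survival_ge _ _ _ P (xi s) N x y eps s (mxi s) ind s0 law
  eps0 eps1 epsx epsy s1 K K0 N0.
lra.
Qed.

Let invn_gt0 n : 0 < n.+1%:R^-1 :> R. Proof. by rewrite invr_gt0. Qed.

Let invn_le1 n : n.+1%:R^-1 <= 1 :> R.
Proof. by rewrite invf_le1// ler1n. Qed.

Let nz n : n.+1%:R != 0 :> R. Proof. by rewrite pnatr_eq0. Qed.

(** Thresholds [e / n], meshes [n ^ -6] and horizons [n]: the overshoot is
[O (1 / n)], and the lower limit of the survival times is at least the collision
time. *)
Lemma collision_expectation_le : (\int[P]_w tau w <= (x * y)%:E)%E.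
Proof.
pose e := Num.min 1 (Num.min x y).
have e0 : 0 < e by rewrite !lt_min ltr01 x0 y0.
have e1 : e <= 1 by rewrite ge_min lexx.
have ex : e <= x by rewrite /e !ge_min lexx orbT.
have ey : e <= y by rewrite /e !ge_min lexx !orbT.
pose q n : R := n.+1%:R^-1.
pose eps n := e * q n; pose s n := q n ^+ 3; pose N n := (n.+1 ^ 7)%N.
have q0 n : 0 < q n by exact: invn_gt0.
have q1 n : q n <= 1 by exact: invn_le1.
have s0 n : 0 < s n by rewrite exprn_gt0.
have s1 n : s n <= 1 by rewrite exprn_ile1// ltW.
have eps0 n : 0 < eps n by rewrite mulr_gt0.
have epse n : eps n <= e by rewrite ler_piMr// ltW.
have horizon n : s n ^+ 2 *+ N n = n.+1%:R.
  rewrite -mulr_natr natrX /s /q.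
  by move: (n.+1%:R : R) (nz n) => b b0; field.
pose A := 1 + x ^+ 2 + y ^+ 2; pose C := C0 * e ^- 3 * (A + 4).
have A0 : 0 <= A by rewrite !addr_ge0 ?sqr_ge0.
have errE n : overshoot_err (N n) x y (eps n) (s n) *+ N n <= C / n.+1%:R.
  rewrite overshoot_errE horizon -[_ *+ N n]mulr_natr natrX -/A.
  have -> : C0 * eps n ^- 3 * s n ^+ 4 * (A + 4 * n.+1%:R) * n.+1%:R ^+ 7 =
      C0 * e ^- 3 * (A / n.+1%:R + 4) / n.+1%:R.
    rewrite /eps /s /q; move: (n.+1%:R : R) (nz n) => b b0.
    by field; rewrite b0 gt_eqF.
  rewrite ler_wpM2r// ler_wpM2l ?mulr_ge0 ?invr_ge0 ?exprn_ge0 ?(ltW e0)//.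
  by rewrite lerD2r ler_piMr.
have rhoE n : (\int[P]_w (rho (eps n) (s n) (N n) w)%:E <= (x * y + C / n.+1%:R)%:E)%E.
  apply: le_trans (expectation_rho_le _ _ _ _ _ _ _) _ => //.
  - exact: le_trans (epse n) e1.
  - exact: le_trans (epse n) ex.
  - exact: le_trans (epse n) ey.
  - by rewrite lee_fin lerD2l.
pose r n w := (rho (eps n) (s n) (N n) w)%:E.
have r0 n w : (0 <= r n w)%E by rewrite lee_fin rho_ge0.
have mr n : measurable_fun [set: T] (r n) by exact/measurable_EFinP/mrho.
have liminf0 w : (0 <= limn_einf (r ^~ w))%E by apply: (@le_limn_einf _ _ _ 0%N).
apply: (@le_trans _ _ (\int[P]_w limn_einf (r ^~ w)))%E.
  apply: ge0_le_integral_ae => //.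
  apply: filterS ae_good => w gw; apply: lee_from_below => // t t0 t_tau.
  have [cF cG F0 G0] := gw.
  have F00 : 0 < gapL w 0 by rewrite F0.
  have G00 : 0 < gapR w 0 by rewrite G0.
  have [m m0 hm] := grid_alive_before_collision cF cG F00 G00 t0 t_tau.
  pose n0 := Num.truncn (t + m^-1).
  have tm0 : 0 <= t + m^-1 by rewrite addr_ge0// invr_ge0 ltW.
  have /andP[_ hn0] := truncn_itv tm0.
  apply: (@le_limn_einf _ _ _ n0) => k nk.
  have kn : t + m^-1 <= k.+1%:R.
    by rewrite (le_trans (ltW hn0))// ler_nat ltnS.
  have tk : t <= k.+1%:R by apply: le_trans kn; rewrite lerDl invr_ge0 ltW.
  have epsm : eps k <= m.
    apply: (@le_trans _ _ (q k)); first by rewrite ler_piMl// ltW.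
    rewrite /q -[leRHS]invrK lef_pV2 ?posrE ?invr_gt0//.
    by apply: le_trans kn; rewrite lerDr.
  have := hm (eps k) (s k ^+ 2) (N k) epsm (exprn_gt0 _ (s0 k)).
  by rewrite horizon (min_idPl tk) lee_fin (rho_grid _ _ _ gw).
apply: le_trans (fatou _ _ _ _) _ => //.
exact: (@limn_einf_le_harmonic _ _ _ C rhoE).
Qed.

(** With the threshold and the horizon [m] fixed and the mesh tending to [0], the
survival times are eventually below any time that exceeds the collision time.
Fatou's lemma is applied to what they leave of the horizon. *)
Let collision_expectation_ge_aux (eps K : R) (m : nat) :
  0 < eps -> eps <= 1 -> eps <= x -> eps <= y -> 0 < K -> (0 < m)%N ->
  ((x * y - (eps * (x + y) + K ^+ 2 * (x * y / m%:R) + x * y * (x + y) / K))%:E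
    <= \int[P]_w tau w)%E.
Proof.
move=> eps0 eps1 epsx epsy K0 m0.
set stuff := eps * (x + y) + _ + _.
pose s n : R := n.+1%:R^-1; pose N n := (m * n.+1 ^ 2)%N.
have s0 n : 0 < s n by exact: invn_gt0.
have s1 n : s n <= 1 by exact: invn_le1.
have mR : 0 < m%:R :> R by rewrite ltr0n.
have horizon n : s n ^+ 2 *+ N n = m%:R.
  rewrite -mulr_natr natrM natrX /s.
  by move: (n.+1%:R : R) (nz n) => b b0; field.
pose A := 1 + x ^+ 2 + y ^+ 2 + 4 * m%:R; pose C := C0 * eps ^- 3 * A * m%:R.
have A0 : 0 <= A by rewrite !addr_ge0 ?sqr_ge0 ?mulr_ge0.
have C_ge0 : 0 <= C by rewrite !mulr_ge0 ?invr_ge0 ?exprn_ge0 ?(ltW eps0).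
pose err n := overshoot_err (N n) x y eps (s n) *+ N n.
have errE n : err n <= C / n.+1%:R.
  rewrite /err overshoot_errE horizon -[_ *+ N n]mulr_natr natrM natrX -/A.
  have -> : C0 * eps ^- 3 * s n ^+ 4 * A * (m%:R * n.+1%:R ^+ 2) =
      C / n.+1%:R / n.+1%:R.
    rewrite /C /s; move: (n.+1%:R : R) (nz n) => b b0.
    by field; rewrite b0 gt_eqF.
  by rewrite ler_piMr// divr_ge0.
pose D := C * (1 + K ^+ 2 / m%:R + K^-1).
have rhoE n : ((x * y - stuff - D / n.+1%:R)%:E <=
    \int[P]_w (rho eps (s n) (N n) w)%:E)%E.
  have N0 : (0 < N n)%N by rewrite /N muln_gt0 m0 expn_gt0.
  apply: le_trans (expectation_rho_ge (s0 n) (s1 n) eps0 eps1 epsx epsy K0 N0).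
  rewrite lee_fin -/(err n) horizon.
  have e1 : K ^+ 2 * ((x * y + err n) / m%:R) <=
      K ^+ 2 * (x * y / m%:R) + K ^+ 2 * (C / n.+1%:R / m%:R).
    by rewrite mulrDl mulrDr lerD2l ler_wpM2l ?sqr_ge0// ler_wpM2r ?invr_ge0.
  have e2 : (x * y * (x + y) + err n) / K <= x * y * (x + y) / K + C / n.+1%:R / K.
    by rewrite mulrDl lerD2l ler_wpM2r// invr_ge0 ltW.
  have e3 := errE n.
  have e4 : D / n.+1%:R = C / n.+1%:R + K ^+ 2 * (C / n.+1%:R / m%:R) + C / n.+1%:R / K.
    by rewrite /D; ring.
  have lin (p c u v u' v' w a b c' : R) : u' <= u + a -> v' <= v + b -> w <= c' ->
      p - (c + u + v) - (c' + a + b) <= p - (c + w + u' + v') by lra.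
  by rewrite e4 /stuff; exact: lin.
(* the complement of the survival time within the horizon [m] *)
pose u n w := (m%:R - rho eps (s n) (N n) w)%:E.
have u0 n w : (0 <= u n w)%E.
  by rewrite lee_fin subr_ge0 (le_trans (rho_le _ _ _ _))// horizon.
have mu n : measurable_fun [set: T] (u n).
  by apply/measurable_EFinP; apply: measurable_funB => //; exact: mrho.
pose h w := limn_einf (u ^~ w).
have h0 w : (0 <= h w)%E by apply: (@le_limn_einf _ _ _ 0%N).
have hm w : (h w <= m%:R%:E)%E.
  apply: (@limn_einf_le_harmonic _ _ _ 0) => k.
  by rewrite mul0r addr0 lee_fin gerBl rho_ge0.
have mh : measurable_fun [set: T] h.
  have -> : h = (-%E \o (fun w => limn_esup (fun n => (- u n w)%E)))%E by [].
  apply: measurableT_comp => //; apply: measurable_fun_limn_esup => k.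
  exact: measurableT_comp.
have hfin w : h w \is a fin_num.
  by rewrite ge0_fin_numE// (le_lt_trans (hm w))// ltry.
have g0 w : (0 <= m%:R%:E - h w)%E by rewrite leeBrDr// add0e.
have Ih : (\int[P]_w h w <= (m%:R - (x * y - stuff))%:E)%E.
  apply: le_trans (fatou _ _ mu _) _ => //.
  apply: (@limn_einf_le_harmonic _ _ _ D) => k.
  have : (\int[P]_w u k w + \int[P]_w (rho eps (s k) (N k) w)%:E = m%:R%:E)%E.
    rewrite -ge0_integralD//.
    - rewrite -[RHS](integral_probability_cst P); apply: eq_integral => w _.
      by rewrite /u -EFinD subrK.
    - by move=> w _; rewrite lee_fin rho_ge0.
    - by apply/measurable_EFinP; exact: mrho.
  move=> sumE; have := leeD2l (\int[P]_w u k w)%E (rhoE k).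
  have lin (a b c : R) : a - (b - c) <= a - b + c by lra.
  rewrite sumE -leeBrDr// -EFinB => /le_trans; apply.
  by rewrite lee_fin; exact: lin.
have gE : {ae P, forall w, (m%:R%:E - h w <= tau w)%E}.
  apply: filterS ae_good => w gw; apply: lee_from_above => // t tau_t.
  rewrite leeBlDr// -leeBlDl// -EFinB.
  have [cF cG F0 G0] := gw.
  have [eta eta0 heta] := grid_alive_after_collision cF cG tau_t eps0.
  apply: (@le_limn_einf _ _ _ (Num.truncn eta^-1).+1) => k nk.
  rewrite lee_fin lerD2l lerN2 (rho_grid _ _ _ gw); apply: heta.
    by rewrite exprn_gt0.
  have eta0' : 0 <= eta^-1 by rewrite invr_ge0 ltW.
  have /andP[_ hn] := truncn_itv eta0'.
  apply: (@le_lt_trans _ _ (s k)); first by rewrite expr2 ler_piMr ?s1 ?(ltW (s0 k)).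
  rewrite /s -[ltRHS]invrK ltf_pV2 ?posrE ?invr_gt0//.
  by rewrite (lt_le_trans hn)// ler_nat leqW.
apply: (@le_trans _ _ (\int[P]_w (m%:R%:E - h w)%E)%E); last first.
  exact: ge0_le_integral_ae.
have sumE : (\int[P]_w (m%:R%:E - h w)%E + \int[P]_w h w = m%:R%:E)%E.
  rewrite -ge0_integralD//.
  - rewrite -[RHS](integral_probability_cst P); apply: eq_integral => w _.
    by rewrite subeK.
  - by apply: emeasurable_funB.
have := leeD2l (\int[P]_w (m%:R%:E - h w))%E Ih.
rewrite sumE -leeBlDr// -EFinB => /(le_trans _); apply.
by rewrite lee_fin; lra.
Qed.

Lemma collision_expectation_ge : ((x * y)%:E <= \int[P]_w tau w)%E.
Proof.
apply/lee_addgt0Pr => e e0.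
pose K := 3 * (x * y * (x + y)) / e.
have xy0 : 0 < x * y by rewrite mulr_gt0.
have xpy : 0 < x + y by rewrite addr_gt0.
have K0 : 0 < K by rewrite divr_gt0// mulr_gt0// mulr_gt0.
pose eps := Num.min (Num.min 1 (e / 3 / (x + y))) (Num.min x y).
have eps0 : 0 < eps by rewrite !lt_min ltr01 x0 y0 !divr_gt0.
have eps1 : eps <= 1 by rewrite /eps !ge_min lexx.
have epse : eps <= e / 3 / (x + y) by rewrite /eps !ge_min lexx orbT.
have epsx : eps <= x by rewrite /eps !ge_min lexx !orbT.
have epsy : eps <= y by rewrite /eps !ge_min lexx !orbT.
pose b := 3 * (K ^+ 2 * (x * y)) / e.
have b0 : 0 <= b by rewrite divr_ge0 ?(ltW e0)// mulr_ge0// mulr_ge0 ?sqr_ge0// ltW.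
have /andP[_ bm] := truncn_itv b0.
have aux := collision_expectation_ge_aux eps0 eps1 epsx epsy K0 (ltn0Sn (Num.truncn b)).
apply: le_trans (leeD2r e%:E aux); rewrite -EFinD lee_fin.
have h1 : eps * (x + y) <= e / 3 by rewrite -ler_pdivlMr.
have h2 : x * y * (x + y) / K <= e / 3.
  rewrite ler_pdivrMr// /K le_eqVlt; apply/orP; left; apply/eqP.
  by field; rewrite gt_eqF.
have h3 : K ^+ 2 * (x * y / (Num.truncn b).+1%:R) <= e / 3.
  rewrite mulrA ler_pdivrMr// [leRHS]mulrC -ler_pdivrMr ?divr_gt0//.
  rewrite (_ : _ / (e / 3) = b) ?(ltW bm)// /b; field.
  by rewrite gt_eqF.
have lin (p u v w : R) : u <= e / 3 -> v <= e / 3 -> w <= e / 3 ->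
  p <= p - (u + v + w) + e by lra.
exact: lin.
Qed.

End collision.

Unset Implicit Arguments.

Theorem theorem3p7 (d : measure_display) (T : measurableType d) (R : realType)
    (P : probability T R) (x y : R) (BL BM BR : R -> {RV P >-> R})
    (hx : 0 < x) (hy : 0 < y)
    (hBL : standard_brownian_motion (- x) BL)
    (hBM : standard_brownian_motion 0 BM)
    (hBR : standard_brownian_motion y BR)
    (hindep : independent_processes [tuple BL; BM; BR]) :
  (\int[P]_w collision_time BL BM BR w = (x * y)%:E)%E.
Proof.
apply/eqP; rewrite eq_le; apply/andP; split.
  exact: collision_expectation_le.
exact: collision_expectation_ge.
Qed.
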